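(* Let $1\le n<\omega$, let $\lambda$ be a regular uncountable cardinal, and let $\mathcal C$ be a $\mathrm{Sq}^s_n(\lambda)$-sequence. Let $\mathfrak r_n$ be the function obtained by performing $n$-dimensional walks along $\mathcal C$. Then the family $$\Phi(\mathfrak r_n)=\Big\langle \mathfrak r_n(\cdot,\vec\gamma):\gamma_0\to\bigoplus_{[\lambda]^{n-1}}\mathbb Z\ \Big|\ \vec\gamma\in[\lambda]^n\Big\rangle$$ is nontrivial modulo locally semi-constant functions.
   Context: Conventions. For a set $A$ of ordinals: $\mathrm{ssup}(A)=\sup\{\alpha+1\mid\alpha\in A\}$, $\mathrm{acc}^+(A)=\{\beta<\mathrm{ssup}(A)\mid\sup(A\cap\beta)=\beta>0\}$, $\mathrm{acc}(A)=A\cap\mathrm{acc}^+(A)$. $E$ is club in a set $B$ of ordinals if $E\subseteq B$, $\mathrm{ssup}(E)=\mathrm{ssup}(B)$, $\mathrm{acc}^+(E)\subseteq E$; $D$ is club in an ordinal $\delta$ if it is club in the set $\delta$. $[A]^k$ ($[A]^{\le k}$) denotes strictly increasing sequences of length $k$ ($\le k$) from $A$; $\lambda^{[k]}$ denotes weakly increasing sequences of length $k$. $\vec\gamma^i$ is $\vec\gamma$ with its $i$-th entry removed; $\beta\vec\gamma=\langle\beta\rangle^\frown\vec\gamma$; $C_\alpha=C_{\langle\alpha\rangle}$. $n$-$C$-sequences: for $D$ club in an infinite ordinal $\delta$, an $n$-$C$-sequence on $D$ is $\mathcal C=\langle C_{\vec\gamma}\mid\vec\gamma\in I(\mathcal C)\rangle$,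 $I(\mathcal C)\subseteq[D]^{\le n}$, $\emptyset\in I(\mathcal C)$, $C_\emptyset=D$, and for $\beta\vec\gamma\in[D]^{\le n}$: $\beta\vec\gamma\in I(\mathcal C)$ iff $\vec\gamma\in I(\mathcal C)$ and $\beta\in C_{\vec\gamma}$, in which case $C_{\beta\vec\gamma}$ is club in $\beta\cap C_{\vec\gamma}$ (and $\emptyset$ if that set is empty). $X(\mathcal C)$ is the set of $\alpha\in D$ with $\alpha\in\mathrm{acc}(C_{\vec\gamma})$ for some $\vec\gamma\in I(\mathcal C)\cap[D]^n$. $\mathcal C$ is coherent if for every $\alpha\in X(\mathcal C)$: (i) $C_{\vec\gamma}\cap\alpha=C_\alpha$ whenever $\vec\gamma\in I(\mathcal C)\cap[D]^n$ and $\alpha\in\mathrm{acc}(C_{\vec\gamma})$; (ii) $C_{\vec\beta}=C_\alpha$ whenever $\vec\beta\in I(\mathcal C)$, $\beta_0=\alpha$, $\sup(C_{\vec\beta})=\alpha$. For $n\ge2$ and $\delta\in D$, $\mathcal C^\delta$ is the $(n-1)$-$C$-sequence on $C_\delta$ with $I(\mathcal C^\delta)=\{\vec\gamma\in[C_\delta]^{\le n-1}\mid\vec\gamma^\frown\langle\delta\rangle\in I(\mathcal C)\}$ and $C^\delta_{\vec\gamma}=C_{\vec\gamma^\frown\langle\delta\rangle}$. A coherent $n$-$C$-sequence $\mathcal C$ on $D$ (club in $\delta$) is nontrivial if there is no coherent $n$-$C$-sequence $\mathcal C'$ on $D\cup\{\delta\}$ with $I(\mathcal C')\cap[\delta]^{\le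 n}=I(\mathcal C)$ and $C'_{\vec\gamma}=C_{\vec\gamma}$ for all nonempty $\vec\gamma\in I(\mathcal C)$. It is strongly nontrivial if $\mathrm{otp}(D)$ is a regular uncountable cardinal and either $n=1$ and $\mathcal C$ is nontrivial, or $n>1$ and $\{\gamma\in D\mid\mathcal C^\gamma$ is strongly nontrivial$\}$ is stationary in $\delta$. A $\mathrm{Sq}^s_n(\lambda)$-sequence is a strongly nontrivial coherent $n$-$C$-sequence on $D=\lambda$. Walks along an $n$-$C$-sequence $\mathcal C$ on $\lambda$. For $\vec\beta\in\lambda^{[n+1]}$ write $\vec\beta=\iota(\vec\beta)^\frown\tau(\vec\beta)$ with $\tau(\vec\beta)$ the longest final segment of $\vec\beta$ in $I(\mathcal C)$, and $j=|\iota(\vec\beta)|-1$. For $(\alpha,\vec\gamma)\in\lambda^{[n+1]}$ build a finite labelled tree $S_n(\alpha,\vec\gamma)\subseteq{}^{<\omega}n$: the root has label $(+1,\alpha,\vec\gamma)$; a node $x$ with label $((-1)^m,\vec\beta)$ is terminal if $C_{\tau(\vec\beta)}\setminus\beta_j=\emptyset$; otherwise with $\delta=\min(C_{\tau(\vec\beta)}\setminus\beta_j)$, $\vec\beta'=\iota(\vec\beta)^\frown\langle\delta\rangle^\frown\tau(\vec\beta)$ (entries indexed $0,\dots,n+1$) and $\ell_0<\dots<\ell_{n-1}$ enumerating $\{1,\dots,n+1\}\setminus\{j+1\}$, the node $x$ has children $x^\frown\langle i\rangle$ ($i<n$) labelled $((-1)^{m+j+\ell_i},(\vec\beta')^{\ell_i})$.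 A label $((-1)^m,\beta_0,\dots,\beta_n)$ contributes $(-1)^m\lfloor\langle\beta_2,\dots,\beta_n\rangle\rfloor$, where $\lfloor e\rfloor$ is the basis element indexed by $e$ of the free abelian group $\bigoplus_{\lambda^{[n-1]}}\mathbb Z$; $\mathfrak r_n(\alpha,\vec\gamma)$ is the sum of contributions of all nodes of $S_n(\alpha,\vec\gamma)$. Triviality. A function $\varphi:\gamma\to H$ is locally semi-constant if for every limit $\alpha\le\gamma$ there is $\eta<\alpha$ with $\varphi$ constant on $(\eta,\alpha)$. An $n$-family $\langle\varphi_{\vec\gamma}:\gamma_0\to H\mid\vec\gamma\in[\lambda]^n\rangle$ is trivial modulo locally semi-constant functions if either $n=1$ and there is $\psi:\lambda\to H$ with $\varphi_\gamma-\psi\restriction\gamma$ locally semi-constant for all $\gamma<\lambda$, or $n>1$ and there is a family $\langle\psi_{\vec\beta}:\beta_0\to H\mid\vec\beta\in[\lambda]^{n-1}\rangle$ such that $\varphi_{\vec\gamma}-\sum_{i<n}(-1)^i\psi_{\vec\gamma^i}$ (restricted to $\gamma_0$) is locally semi-constant for every $\vec\gamma\in[\lambda]^n$. Nontrivial means not trivial. *)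

(* Defs.v *)
(* Ordinals are the elements of a well-ordered [bOrderType]
   without a greatest element (see [ordinals_like]), identified with their sets
   of predecessors; sets of ordinals are classical sets over that type. *)
From HB Require Import structures.
From mathcomp Require Import all_boot all_order all_algebra.
From mathcomp Require Import boolp classical_sets functions cardinality fsbigop.
From mathcomp Require Import freeg.

Set Implicit Arguments.
Unset Strict Implicit.
Unset Printing Implicit Defensive.

Import Order.TTheory GRing.Theory.

Local Open Scope classical_set_scope.
Local Open Scope card_scope.
Local Open Scope order_scope.

Section Ordinals.
Context {d : Order.disp_t} {O : bOrderType d}.
Implicit Types (A B D E S : set O) (a b g : O).

(* Every notion below only involves ordinals up to a successor of the ordinals
   in sight, so a well-order without maximum can stand for the class of all
   ordinals; [\bot] is the ordinal 0. *)
Definition ordinals_like : Prop :=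
  well_founded (fun x y : O => x < y) /\ (forall x : O, exists y, x < y).

(* The ordinal [a] as the set of its elements. *)
Definition below a : set O := [set x | x < a].

(* Meaningful for nonempty [A]; the default is never relevant. *)
Definition omin A : O := xget \bot [set x | A x /\ lbound A x].

Definition osucc a : O := omin [set x | a < x].

(* [supremum \bot set0 = \bot], i.e. sup of the empty set is 0. *)
Definition osup A : O := supremum \bot A.

Definition ssup A : O := osup (osucc @` A).

Definition accp A : set O :=
  [set b | [/\ b < ssup A, osup (A `&` below b) = b & \bot < b]].

Definition acc A : set O := A `&` accp A.

Definition limit_ordinal a : Prop :=
  \bot < a /\ (forall x, x < a -> osucc x < a).

Definition infinite_ordinal a : Prop := infinite_set (below a).

Definition club E B : Prop :=
  [/\ E `<=` B, ssup E = ssup B & accp E `<=` E].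

Definition stationary S a : Prop :=
  forall E, club E (below a) -> (S `&` E) !=set0.

Definition is_cardinal a : Prop :=
  forall b, b < a -> ~ (below a #<= below b).

Definition regular_uncountable a : Prop :=
  [/\ is_cardinal a, ~ countable (below a) &
      forall A, A `<=` below a -> osup A = a -> A #= below a].

Definition otp_is A k : Prop :=
  exists f : O -> O,
    (forall x y, A x -> A y -> x < y -> f x < f y) /\ f @` A = below k.

(* Strictly increasing sequences from [A], of length [k] resp. at most [k]. *)
Definition incr A (k : nat) : set (seq O) :=
  [set s | [/\ sorted <%O s, size s = k & forall x, x \in s -> A x]].
Definition incr_le A (k : nat) : set (seq O) :=
  [set s | [/\ sorted <%O s, (size s <= k)%N & forall x, x \in s -> A x]].

End Ordinals.

Arguments ordinals_like {d} O.

Definition del (T : Type) (i : nat) (s : seq T) : seq T :=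
  take i s ++ drop i.+1 s.

Section CSequences.
Context {d : Order.disp_t} {O : bOrderType d}.

(* The clubs [clb s] are only meaningful for [s] in [idx]. *)
Record Cseq := MkCseq {
  idx : set (seq O);
  clb : seq O -> set O }.

Implicit Types (C : Cseq) (D : set O) (b g : seq O).

Definition is_Cseq (n : nat) D C : Prop :=
  (exists2 dl : O, infinite_ordinal dl & club D (below dl)) /\
  [/\ idx C `<=` incr_le D n, idx C [::], clb C [::] = D &
      forall (x : O) g, incr_le D n (x :: g) ->
        (idx C (x :: g) <-> idx C g /\ clb C g x) /\
        (idx C (x :: g) -> club (clb C (x :: g)) (below x `&` clb C g))].

Definition Xset (n : nat) C : set O :=
  [set a | clb C [::] a /\
           exists g, [/\ idx C g, size g = n & acc (clb C g) a]].

Definition coherent (n : nat) C : Prop :=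
  forall a : O, Xset n C a ->
    (forall g, idx C g -> size g = n -> acc (clb C g) a ->
       clb C g `&` below a = clb C [:: a]) /\
    (forall b, idx C (a :: b) -> osup (clb C (a :: b)) = a ->
       clb C (a :: b) = clb C [:: a]).

(* The (n-1)-C-sequence C^dl of an n-C-sequence [C]. *)
Definition Csub (n : nat) C (dl : O) : Cseq := MkCseq
  [set g | incr_le (clb C [:: dl]) n.-1 g /\ idx C (rcons g dl)]
  (fun g => clb C (rcons g dl)).

(* A set D that is club in the ordinal dl determines dl = ssup D. *)
Definition nontrivial (n : nat) C : Prop :=
  let D := clb C [::] in let dl := ssup D in
  ~ exists C' : Cseq,
      [/\ is_Cseq n (D `|` [set dl]) C', coherent n C',
          idx C' `&` incr_le (below dl) n = idx C &
          forall g, idx C g -> g <> [::] -> clb C' g = clb C g].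

Fixpoint strongly_nontrivial (n : nat) C : Prop :=
  let D := clb C [::] in
  (exists2 k : O, regular_uncountable k & otp_is D k) /\
  match n with
  | 0 => False
  | m.+1 =>
    if m is 0 then nontrivial 1 C
    else stationary [set g | D g /\ strongly_nontrivial m (Csub m.+1 C g)]
                    (ssup D)
  end.

Definition Sq_s (n : nat) (lam : O) C : Prop :=
  [/\ is_Cseq n (below lam) C, coherent n C & strongly_nontrivial n C].

End CSequences.

Section Walks.
Local Open Scope ring_scope.
Context {d : Order.disp_t} {O : bOrderType d}.
Variables (n : nat) (C : Cseq (O := O)).

(* The length of iota(b): [drop (iota_size b) b] is the longest final segment
   of [b] in [idx C]. *)
Definition iota_size (b : seq O) : nat :=
  find (fun i => `[< idx C (drop i b) >]) (iota 0 (size b).+1).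

(* A label ((-1)^m, b) is encoded as the pair (m, b). *)
Definition child (l : nat * seq O) (i : nat) : option (nat * seq O) :=
  let: (m, b) := l in
  let k := iota_size b in
  let j := k.-1 in
  let A := clb C (drop k b) `\` below (nth \bot%O b j) in
  if `[< A = set0 >] || (n <= i)%N then None else
  let b' := take k b ++ omin A :: drop k b in
  let li := nth 0%N (rem j.+1 (iota 1 n.+1)) i in
  Some ((m + j + li)%N, del li b').

(* [None] when the sequence [x] is not a node of the tree S_n(a, g). *)
Definition node_label (a : O) (g : seq O) (x : seq nat)
    : option (nat * seq O) :=
  foldl (fun o i => obind (fun l => child l i) o) (Some (0%N, a :: g)) x.

Definition walk_tree (a : O) (g : seq O) : set (seq nat) :=
  [set x | node_label a g x <> None].

Definition contribution (l : nat * seq O) : {freeg (seq O)} :=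
  << (-1) ^+ l.1 *g drop 2 l.2 >>.

(* Contributions never vanish, so this finitely supported sum is the sum over
   all nodes as soon as the tree is finite. *)
Definition walk_r (a : O) (g : seq O) : {freeg (seq O)} :=
  \sum_(x \in walk_tree a g) oapp contribution 0 (node_label a g x).

End Walks.

(* The direct sum of copies of Z over the strictly increasing sequences of
   length [k] from [lam], as a subgroup of the free group on all sequences. *)
Definition free_incr (d : Order.disp_t) (O : bOrderType d) (lam : O) (k : nat)
    : set {freeg (seq O)} :=
  [set h | forall e, e \in dom h -> incr (below lam) k e].

Section Triviality.
Local Open Scope ring_scope.
Context {d : Order.disp_t} {O : bOrderType d} {M : zmodType}.

(* [f] is only considered on [below g]. *)
Definition locally_semi_constant (g : O) (f : O -> M) : Prop :=
  forall a : O, (a <= g)%O -> limit_ordinal a ->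
    exists2 eta : O, (eta < a)%O &
      forall x y : O, (eta < x < a)%O -> (eta < y < a)%O -> f x = f y.

(* Families of functions with values in a subgroup [H] of [M]; the member
   indexed by [g] is only considered on [below (head \bot g)]. *)
Definition family_in (H : set M) (n : nat) (lam : O)
    (phi : seq O -> O -> M) : Prop :=
  forall g, incr (below lam) n g ->
    forall a : O, (a < head \bot g)%O -> H (phi g a).

Definition trivial_mod_lsc (H : set M) (n : nat) (lam : O)
    (phi : seq O -> O -> M) : Prop :=
  (n = 1%N /\
   exists psi : O -> M,
     (forall a, (a < lam)%O -> H (psi a)) /\
     forall g : O, (g < lam)%O ->
       locally_semi_constant g (fun a => phi [:: g] a - psi a)) \/
  ((1 < n)%N /\
   exists psi : seq O -> O -> M,
     family_in H n.-1 lam psi /\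
     forall g, incr (below lam) n g ->
       locally_semi_constant (head \bot%O g)
         (fun a => phi g a - \sum_(i < n) psi (del i g) a *~ (-1) ^+ i)).

End Triviality.

(* Main.v *)
Require Import Defs.
From HB Require Import structures.
From mathcomp Require Import all_boot all_order all_algebra.
From mathcomp Require Import boolp classical_sets functions cardinality fsbigop.
From mathcomp Require Import freeg.
From mathcomp Require Import zify.

(* Induction on n, for C-sequences on an arbitrary closed set D whose order type
   is regular uncountable.

   n = 1: for a < g in D, the walk from g to a has exactly two nodes iff a is in
   C_g.  If psi trivialised the walks, then by pressing down there would be
   unboundedly many limits g of D for which the length of the walk from g to a,
   minus psi(a), takes the same value c for all a in (eta, g), with eta and c
   fixed.  For two such g < h the clubs C_g and C_h agree on (eta, g), so
   C_g = C_h \cap g by coherence, and the union of these C_g threads the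
   C-sequence.

   n > 1: keep only the basis elements whose last entry is z, and erase z.  This
   maps r_n(a, g^z) to r_{n-1}(a, g) computed along C^z, since removing z from a
   label makes all later labels end below z.  Given a trivialisation psi of r_n,
   the z for which the supports of psi_b(a), b and a below z, stay below z form a
   club, so some such z has C^z strongly nontrivial; projecting psi then
   trivialises r_{n-1} along C^z. *)

Set Implicit Arguments.
Unset Strict Implicit.
Unset Printing Implicit Defensive.

Import Order.TTheory GRing.Theory Num.Theory.

Local Open Scope classical_set_scope.
Local Open Scope card_scope.
Local Open Scope order_scope.
Local Arguments child : simpl never.

(** The condition sup(A ∩ b) = b > 0 in order-theoretic form, free of the defaults hidden in [osup].
    Unlike [accp], it puts no bound on b. *)
Definition limpt {d : Order.disp_t} {O : bOrderType d} (A : set O) (b : O) : Prop :=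
  \bot < b /\ forall x, x < b -> exists y, [/\ A y, x < y & y < b].

(** Hilbert's hotel: f is a section of a surjection from A onto the natural numbers, and h sends f 0
    to x, f (i+1) to f i, and fixes the rest. *)
Lemma card_le_setU1 (T : Type) (A : set T) x :
  infinite_set A -> x |` A #<= A.
Proof.
move=> /infiniteP/pcard_surjP[g gA].
have /choice[f fP] : forall i, exists y, A y /\ g y = i.
  by move=> i; have [y Ay <-] := gA i I; exists y.
pose h y := if pselect (exists i, y = f i) is left p
            then (if g y is i.+1 then f i else x) else y.
apply/card_le_trans/(card_image_le h)/subset_card_le => y.
have [[i ->] _|noi] := pselect (exists i, y = f i).
  exists (f i.+1); first by case: (fP i.+1).
  rewrite /h; case: pselect => [_|[]]; last by exists i.+1.
  by case: (fP i.+1) => _ ->.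
case=> [->|Ay].
  exists (f 0%N); first by case: (fP 0%N).
  rewrite /h; case: pselect => [_|[]]; last by exists 0%N.
  by case: (fP 0%N) => _ ->.
by exists y => //; rewrite /h; case: pselect.
Qed.

(** * Ordinals: suprema, limit points and clubs *)

Section OrdinalLemmas.
Context {d : Order.disp_t} {O : bOrderType d} (hO : ordinals_like O).
Implicit Types (A B D E S : set O) (a b g x y : O).

Lemma ominP A x : A x -> A (omin A) /\ forall y, A y -> omin A <= y.
Proof.
have [wfO _] := hO; move=> Ax.
suff h : exists z, [set x | A x /\ lbound A x] z by exact: (xgetPex \bot h).
elim/(well_founded_ind wfO): x Ax => x IH Ax.
have [[y [Ay yx]]|noy] := pselect (exists y, A y /\ y < x); first exact: IH Ay.
exists x; split=> // y Ay; rewrite leNgt; apply/negP => yx.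
by apply: noy; exists y.
Qed.

Lemma lt_osucc a : a < osucc a.
Proof. by have [_ /(_ a)[y ay]] := hO; case: (@ominP [set x | a < x] y ay). Qed.

Lemma osucc_le a b : (osucc a <= b) = (a < b).
Proof.
apply/idP/idP; first exact/lt_le_trans/lt_osucc.
by move=> ab; case: (@ominP [set x | a < x] b ab) => _; apply.
Qed.

Lemma lt_osuccE a b : (a < osucc b) = (a <= b).
Proof. by rewrite ltNge osucc_le -leNgt. Qed.

Lemma osup_le A x b : A x -> ubound A b ->
  (forall y, A y -> y <= osup A) /\ osup A <= b.
Proof.
move=> Ax Ab; have [uA lA] := @ominP [set c | ubound A c] b Ab.
have sA : supremums A !=set0 by exists (omin [set c | ubound A c]).
split=> [y Ay|]; first exact: ge_supremum_Nmem.
rewrite /osup /supremum; case: ifP => [/eqP A0|_]; first by move: Ax; rewrite A0.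
by have [_] := xgetPex \bot sA; apply.
Qed.

Lemma lt_ssup A b x : A `<=` below b -> A x -> x < ssup A.
Proof.
move=> Ab Ax; rewrite -osucc_le /ssup.
have Sx : (osucc @` A) (osucc x) by exists x.
have Sb : ubound (osucc @` A) b by move=> _ [y /Ab yb <-]; rewrite osucc_le.
by have [+ _] := osup_le Sx Sb; apply.
Qed.

Lemma ssup_le A b : A `<=` below b -> ssup A <= b.
Proof.
move=> Ab; rewrite /ssup.
have [->|/set0P[x Ax]] := eqVneq A set0.
  by rewrite image_set0 /osup supremum0 le0x.
have Sx : (osucc @` A) (osucc x) by exists x.
have Sb : ubound (osucc @` A) b by move=> _ [y /Ab yb <-]; rewrite osucc_le.
by have [_] := osup_le Sx Sb.
Qed.

Lemma ssup_below a : ssup (below a) = a.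
Proof.
apply/eqP; rewrite eq_le ssup_le //= leNgt; apply/negP => h.
by have := @lt_ssup (below a) a _ (@subset_refl _ _) h; rewrite ltxx.
Qed.

Lemma ssup_cofinal A b x : A `<=` below b -> x < ssup A -> exists2 y, A y & x <= y.
Proof.
move=> Ab xA; have [//|noy] := pselect (exists2 y, A y & x <= y).
move: xA; rewrite ltNge ssup_le // => y Ay /=; rewrite /below /= ltNge; apply/negP => xy.
by apply: noy; exists y.
Qed.

Lemma osup_limpt A b :
  osup (A `&` below b) = b /\ \bot < b <-> limpt A b.
Proof.
have ub : ubound (A `&` below b) b by move=> y [_ /ltW].
split=> [[sAb b0]|[b0 lAb]]; split=> //.
  move=> x xb; apply: contrapT => noy.
  have ux : ubound (A `&` below b) x.
    move=> y [Ay yb]; rewrite leNgt; apply/negP => xy.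
    by apply: noy; exists y; split.
  have [A0|/set0P[y Ay]] := eqVneq (A `&` below b)%classic set0.
    by move: sAb b0; rewrite A0 /osup supremum0 => <-; rewrite ltxx.
  by have [_] := osup_le Ay ux; rewrite sAb leNgt xb.
have [y [Ay _ yb]] := lAb _ b0.
have [ge le] := @osup_le (A `&` below b) y b (conj Ay yb) ub.
apply/eqP; rewrite eq_le le leNgt; apply/negP => /lAb[z [Az ltz zb]].
by have := ge z (conj Az zb); rewrite leNgt ltz.
Qed.

Lemma accpE A b : accp A b <-> b < ssup A /\ limpt A b.
Proof.
split=> [[bA sAb b0]|[bA /osup_limpt[sAb b0]]]; split=> //.
exact/osup_limpt.
Qed.

Lemma limptS A B b : A `<=` B -> limpt A b -> limpt B b.
Proof.
move=> AB [b0 h]; split=> // x /h[y [Ay xy yb]].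
by exists y; split=> //; exact: AB.
Qed.

Lemma club_cofinal E B b x : B `<=` below b -> club E B -> B x ->
  exists2 y, E y & x <= y.
Proof.
move=> Bb [EB sE _] Bx; apply: (@ssup_cofinal E b) => [y /EB/Bb//|].
by rewrite sE; exact: lt_ssup Bb Bx.
Qed.

Lemma cofinal_ssup E B b : B `<=` below b -> E `<=` B ->
  (forall x, B x -> exists2 y, E y & x <= y) -> ssup E = ssup B.
Proof.
move=> Bb EB cof; have Eb : E `<=` below b by move=> y /EB/Bb.
apply/eqP; rewrite eq_le; apply/andP; split; apply: ssup_le => x.
  by move=> /EB; exact: (lt_ssup Bb).
by move=> /cof[y Ey xy]; apply: le_lt_trans xy _; exact: (lt_ssup Eb).
Qed.

(** E is cofinal in the part of D below g, which is itself cofinal in g. *)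
Lemma limpt_club E D g b : D `<=` below b ->
  club E (below g `&` D) -> limpt D g -> limpt E g.
Proof.
move=> Db Ecl [g0 lg]; split=> // x /lg[y [Dy xy yg]].
have gDb : below g `&` D `<=` below b by move=> z [_ /Db].
have [z Ez yz] := club_cofinal gDb Ecl (conj yg Dy).
exists z; split=> //; first exact: lt_le_trans xy yz.
by case: Ecl => /(_ _ Ez)[].
Qed.

Lemma club_limpt E B b x : B `<=` below b -> club E B ->
  B x -> limpt E x -> E x.
Proof.
move=> Bb [EB sE cE] Bx lx; apply: cE; apply/accpE; split=> //.
by rewrite sE; exact: (lt_ssup Bb).
Qed.

Lemma limpt_below_limit g : limpt (below g) g -> limit_ordinal g.
Proof.
move=> [g0 lg]; split=> // x /lg[y [_ xy yg]].
by apply: le_lt_trans yg; rewrite osucc_le.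
Qed.

Lemma sup_chain (u : nat -> O) b : (forall i, u i < u i.+1) ->
  (forall i, u i <= b) ->
  exists g, [/\ g <= b, forall i, u i < g &
                forall x, x < g -> exists i, x < u i].
Proof.
move=> uS ub; pose U := ubound (range u).
have Ub : U b by move=> _ [i _ <-].
have [Ug Uleast] := ominP Ub.
exists (omin U); split=> [|i|x xg]; first exact: Uleast.
  by apply: (lt_le_trans (uS i)); apply: Ug; exists i.+1.
apply: contrapT => noi; have : U x.
  move=> _ [i _ <-]; rewrite leNgt; apply/negP => xu.
  by apply: noi; exists i.
by move=> /Uleast; rewrite leNgt xg.
Qed.


(* [D] behaves like a regular uncountable cardinal: it has no maximum, and
   neither an initial segment of [D] nor a sequence is cofinal in it. *)
Definition regular_set D : Prop :=
  [/\ D !=set0,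
      forall x, D x -> exists2 y, D y & x < y,
      forall e (G : O -> O), D e -> (forall x, D x -> x < e -> D (G x)) ->
        exists2 b, D b & forall x, D x -> x < e -> G x <= b &
      forall u : nat -> O, (forall i, D (u i)) ->
        exists2 b, D b & forall i, u i <= b].


(** * Regular order types: bounds and closure points *)

Lemma osup_unbounded k A : A `<=` below k -> A !=set0 ->
  (forall b, b < k -> exists2 x, A x & b < x) -> osup A = k.
Proof.
move=> Ak [x Ax] unb; have ub : ubound A k by move=> y /Ak/ltW.
have [uA le] := osup_le Ax ub.
apply/eqP; rewrite eq_le le leNgt; apply/negP => /unb[y /uA].
by rewrite leNgt => /negP.
Qed.

(** If x were a maximum, k would have at most the size of x. If one of the two bounding clauses
    failed, an image of a smaller ordinal, or of the natural numbers, would be cofinal in k, hence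
    of size k by regularity. This contradicts that k is a cardinal, or that it is uncountable. *)
Lemma regular_uncountable_regular_set k :
  regular_uncountable k -> regular_set (below k).
Proof.
move=> [card_k unc_k reg_k].
have unbounded A : A `<=` below k -> A !=set0 ->
    (forall b, b < k -> exists2 x, A x & b < x) -> A #= below k.
  by move=> Ak A0 /(osup_unbounded Ak A0); exact: reg_k.
have inf_k : infinite_set (below k) by move=> /finite_set_countable.
split.
- exact: infinite_setN0.
- move=> x xk; have [//|nomax] := pselect (exists2 y, below k y & x < y).
  have kE : below k `<=` x |` below x.
    move=> y yk; have [xy|yx|->] := ltgtP x y; last by left.
      by case: nomax; exists y.
    by right.
  case: (card_k x xk).
  have [xfin|xinf] := pselect (finite_set (below x)).
    case: inf_k; apply: sub_finite_set kE _.
    by by rewrite finite_setU; split=> //; exact: finite_set1.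
  exact: card_le_trans (subset_card_le kE) (card_le_setU1 x xinf).
- move=> e G ek Gk.
  have [//|nob] := pselect (exists2 b, below k b &
    forall x, below k x -> x < e -> G x <= b).
  have Gb : G @` below e `<=` below k.
    by move=> _ [x xe <-]; apply: Gk => //; exact: lt_trans ek.
  have unb b : b < k -> exists2 y, (G @` below e) y & b < y.
    move=> bk; apply: contrapT => noy; apply: nob; exists b => // x _ xe.
    rewrite leNgt; apply/negP => bG; by apply: noy; exists (G x).
  case: (card_k e ek).
  suff : G @` below e #= below k.
    by move=> /card_eqPle[_ /card_le_trans]; apply; exact: card_image_le.
  apply: (unbounded) => //.
  have [y Gy _] := unb _ ek.
  by exists y.
- move=> u uk.
  have [//|nob] := pselect (exists2 b, below k b & forall i, u i <= b).
  case: unc_k; have : range u #= below k.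
    apply: (unbounded) => [_ [i _ <-]//||b bk]; first by exists (u 0%N); exists 0%N.
    apply: contrapT => noy; apply: nob; exists b => // i.
    rewrite leNgt; apply/negP => bu; by apply: noy; exists (u i).
  by move=> /card_eqPle[_ /card_le_trans]; apply; exact: card_image_le.
Qed.

(** Each clause is transported along the order isomorphism f, with inverse g. *)
Lemma otp_regular_set D k :
  regular_uncountable k -> otp_is D k -> regular_set D.
Proof.
move=> /regular_uncountable_regular_set[[x0 k0] kS kreg kom] [f [fS fD]].
have fk x : D x -> f x < k by move=> Dx; have : (f @` D) (f x) by [exists x]; rewrite fD.
have /choice[g gP] : forall y, exists x, y < k -> D x /\ f x = y.
  move=> y; have [yk|ny] := pselect (y < k); last by exists y.
  have : below k y by []. rewrite -fD => -[x Dx <-]; by exists x.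
have gD y : y < k -> D (g y) by move=> /gP[].
have fg y : y < k -> f (g y) = y by move=> /gP[].
have fle x y : D x -> D y -> f x <= f y -> x <= y.
  move=> Dx Dy; rewrite !leNgt; apply: contra => yx; exact: fS.
have flt x y : D x -> D y -> f x < f y -> x < y.
  move=> Dx Dy; rewrite !ltNge; apply: contra.
  by rewrite le_eqVlt => /predU1P[->//|yx]; apply/ltW/fS.
split.
- by exists (g x0); apply: gD.
- move=> x Dx; have [y yk xy] := kS _ (fk _ Dx).
  exists (g y); first exact: gD.
  by apply: (flt) => //; [exact: gD|rewrite fg].
- move=> e G De GD; have [|b bk bP] := kreg (f e) (f \o G \o g) (fk _ De).
    move=> y yk yfe; apply/fk/GD; first exact: gD.
    by apply: (flt) => //; [exact: gD|rewrite fg].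
  exists (g b) => [|x Dx xe]; first exact: gD.
  apply: (fle) => //; [exact: GD|exact: gD|rewrite fg//].
  apply: le_trans (bP (f x) (fk _ Dx) (fS _ _ Dx De xe)) => /=.
  suff -> : g (f x) = x by [].
  have fgf : f (g (f x)) = f x by apply/fg/fk.
  by apply/eqP; rewrite eq_le; apply/andP; split; apply: (fle) => //;
    rewrite ?fgf ?lexx//; apply/gD/fk.
- move=> u uD; have [i|b bk bP] := kom (f \o u); first exact/fk.
  exists (g b) => [|i]; first exact: gD.
  by apply: (fle) => //; [exact: gD|rewrite fg//; exact: bP].
Qed.

(** Induction on the length: for a fixed first entry x the values are bounded by some G x, and
    regularity bounds G below e. *)
Lemma regular_set_seq_bound D e m (F : seq O -> O) : regular_set D -> D e ->
  (forall s, D (F s)) ->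
  exists2 b, D b & forall s, size s = m ->
    (forall x, x \in s -> D x /\ x < e) -> F s <= b.
Proof.
move=> [_ _ Dreg _] De; elim: m F => [|m IH] F FD.
  by exists (F [::]) => // s /size0nil ->.
have /choice[G GP] : forall x, exists b, D b /\ forall s, size s = m ->
    (forall y, y \in s -> D y /\ y < e) -> F (x :: s) <= b.
  by move=> x; have [b Db bP] := IH (fun s => F (x :: s)) (fun s => FD _); exists b.
have [b Db bP] := Dreg e G De (fun x _ _ => (GP x).1).
exists b => // -[//|x s] [sm] xs.
have [Dx xe] := xs x (mem_head x s).
apply: le_trans (bP x Dx xe); apply: (GP x).2 => // y ys.
by apply: xs; rewrite inE ys orbT.
Qed.

Lemma regular_set_list_max D (s : seq O) : D !=set0 ->
  exists2 b, D b & forall x, x \in s -> D x -> x <= b.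
Proof.
move=> [x0 Dx0]; elim: s => [|x s [b Db bP]]; first by exists x0.
have [Dx|nDx] := pselect (D x); last first.
  by exists b => // y; rewrite inE => /predU1P[-> //|]; exact: bP.
exists (Order.max x b); first by rewrite /Order.max; case: ifP.
by move=> y; rewrite inE le_max => /predU1P[-> _|/bP h /h ->];
  rewrite ?lexx ?orbT.
Qed.

Definition closure_points D (G : O -> O) : set O :=
  [set g | [/\ D g, limpt D g & forall x, D x -> x < g -> G x < g]].

(** Starting from x0, iterate a function N whose value at x exceeds x and bounds G below x. The
    supremum of these countably many points is a closure point; it stays below [ssup D] because no
    sequence is cofinal in D. *)
Lemma closure_points_cofinal D G x0 b0 : D `<=` below b0 -> accp D `<=` D ->
  regular_set D -> (forall x, D x -> D (G x)) -> D x0 ->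
  exists2 g, closure_points D G g & x0 <= g.
Proof.
move=> Db0 cD [_ Dnomax Dreg Dom] GD Dx0.
have /choice[N NP] : forall x, exists y, D x ->
    [/\ D y, x < y & forall z, D z -> z < x -> G z <= y].
  move=> x; have [Dx|] := pselect (D x); last by exists x.
  have [b Db bP] := Dreg x G Dx (fun z Dz _ => GD z Dz).
  have [|y Dy yP] := Dnomax (Order.max x b).
    by rewrite /Order.max; case: ifP.
  move: yP; rewrite gt_max => /andP[xy by_].
  by exists y => _; split=> // z Dz zx; exact: le_trans (bP z Dz zx) (ltW by_).
pose u i := iter i N x0.
have uD i : D (u i) by elim: i => // i /NP[].
have uS i : u i < u i.+1 by case: (NP _ (uD i)).
have [b Db ub] := Dom u uD.
have [g [gb ug gP]] := sup_chain uS ub.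
have lg : limpt D g.
  split; first exact: le_lt_trans (le0x _) (ug 0%N).
  by move=> x /gP[i xu]; exists (u i).
exists g; last exact/ltW/(ug 0%N).
split=> //.
  by apply: cD; apply/accpE; split=> //; apply: le_lt_trans gb _; exact: (lt_ssup Db0).
move=> x Dx /gP[i xu].
have [_ _ /(_ x Dx xu)] := NP _ (uD i).
by move=> h; apply: le_lt_trans h (ug i.+1).
Qed.

Lemma closure_points_club D G b0 : D `<=` below b0 -> accp D `<=` D ->
  regular_set D -> (forall x, D x -> D (G x)) ->
  club (closure_points D G) (below (ssup D)).
Proof.
move=> Db0 cD rD GD.
have ED : closure_points D G `<=` D by move=> g [].
have sD x : D x -> x < ssup D by exact: lt_ssup Db0.
have Esub : closure_points D G `<=` below (ssup D) by move=> g /ED/sD.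
have sE : ssup (closure_points D G) = ssup (below (ssup D)).
  apply: (cofinal_ssup (@subset_refl _ _) Esub) => x xD.
  have [y Dy xy] := ssup_cofinal Db0 xD.
  have [g Eg yg] := closure_points_cofinal Db0 cD rD GD Dy.
  by exists g => //; exact: le_trans xy yg.
split=> // b /accpE[]; rewrite sE ssup_below => bD lb; split.
- by apply: cD; apply/accpE; split=> //; exact: limptS ED lb.
- exact: limptS ED lb.
- move=> x Dx /(lb.2)[y [[_ _ yP] xy yb]].
  exact: lt_trans (yP x Dx xy) yb.
Qed.

End OrdinalLemmas.

(** * Sums over finitely branching labelled trees *)

Section LabelledTrees.
Local Open Scope ring_scope.
Context {L : Type} {M : zmodType} (ch : L -> nat -> option L) (c : L -> M).

(** [node_label], [walk_tree] and [walk_r] for an arbitrary child function and root label, so that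
    subtrees are covered as well. *)
Definition node_from (l : L) (x : seq nat) : option L :=
  foldl (fun o i => obind (fun l => ch l i) o) (Some l) x.

Definition nodes_from (l : L) : set (seq nat) :=
  [set x | node_from l x <> None].

Definition tree_sum (l : L) : M :=
  \sum_(x \in nodes_from l) oapp c 0 (node_from l x).

Lemma node_from_cons l i x :
  node_from l (i :: x) = obind (node_from^~ x) (ch l i).
Proof.
rewrite /node_from /=; case: (ch l i) => //=.
by elim: x => //= j x ->.
Qed.

(** The nodes are the root and the i :: x with x a node of the i-th subtree; r lists them without
    repetition. Finiteness is proved along with the recursion, because the sum over a set is genuine
    only for finite support. *)
Lemma tree_sum_rec n l : (forall i, (n <= i)%N -> ch l i = None) ->
  (forall i l', ch l i = Some l' -> finite_set (nodes_from l')) ->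
  finite_set (nodes_from l) /\
  tree_sum l = c l + \sum_(i < n) oapp tree_sum 0 (ch l i).
Proof.
move=> chn fin.
have /choice[T TP] : forall i, exists s : seq (seq nat), uniq s /\
    forall l', ch l i = Some l' -> nodes_from l' = [set` s].
  move=> i; case E: (ch l i) => [l'|]; last by exists [::].
  have /finite_seqP[s sE] := fin _ _ E.
  exists (undup s); rewrite undup_uniq; split=> // _ [<-].
  by rewrite sE; apply/seteqP; split=> x /=; rewrite mem_undup.
pose I := [seq i <- iota 0 n | ch l i].
pose r := [::] :: [seq i :: x | i <- I, x <- T i].
have ur : uniq r.
  rewrite /r cons_uniq; apply/andP; split; first by apply/negP => /allpairsPdep[i [x []]].
  apply: allpairs_uniq_dep => [|i _|]; first by rewrite filter_uniq ?iota_uniq.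
    by case: (TP i).
  by move=> /= [i x] [j y] _ _ /= [-> ->].
have rE : nodes_from l = [set` r].
  apply/seteqP; split=> x /=; rewrite /r in_cons.
    case: x => [//|i x]; rewrite /nodes_from /= node_from_cons.
    case E: (ch l i) => [l'|//] /= xl'.
    apply/allpairsPdep; exists i, x; split=> //.
      rewrite mem_filter E mem_iota /= add0n ltnNge; apply/negP => /chn.
      by rewrite E.
    by have := (TP i).2 _ E; move/seteqP => -[/(_ x xl')].
  case/orP => [/eqP -> //|/allpairsPdep[i [y [iI yT ->]]]].
  move: iI; rewrite mem_filter /nodes_from /= node_from_cons.
  case E: (ch l i) => [l'|//] _ /=.
  by have := (TP i).2 _ E; move/seteqP => -[_ /(_ y yT)].
split; first by apply/finite_seqP; exists r.
rewrite /tree_sum rE -fsbig_seq // big_cons /=; congr (_ + _).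
rewrite big_allpairs_dep big_filter big_mkcond /=.
have -> : iota 0 n = index_iota 0 n by rewrite /index_iota subn0.
rewrite big_mkord; apply: eq_bigr => i _.
case E: (ch l i) => [l'|//] /=.
have [uT /(_ _ E) ->] := TP i.
rewrite -fsbig_seq //; apply: eq_bigr => x _.
by rewrite node_from_cons E.
Qed.

End LabelledTrees.

(** * The lexicographic order on sequences of fixed length *)

Section LexOrder.
Context {d : Order.disp_t} {O : bOrderType d}.

Fixpoint lex_lt (s t : seq O) : Prop :=
  match s, t with
  | x :: s', y :: t' => x < y \/ (x = y /\ lex_lt s' t')
  | _, _ => False
  end.

Lemma lex_lt_cat p x y s t : x < y -> lex_lt (p ++ x :: s) (p ++ y :: t).
Proof. by move=> xy; elim: p => [|z p IH] /=; [left|right]. Qed.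

(** Induction on the length, then on the first entry, then on the tail. Fixing the length is
    essential: 1, then 01, then 001, and so on, descends forever. *)
Lemma lex_lt_wf n : ordinals_like O ->
  forall s : seq O, size s = n ->
    Acc (fun s t => size s = size t /\ lex_lt s t) s.
Proof.
move=> [wfO _]; elim: n => [|n IH] s.
  by move=> /size0nil ->; constructor => -[|y t] [].
case: s => [|x s]; first by move/eqP.
move=> /eqP; rewrite eqSS => /eqP; elim/(well_founded_ind wfO): x s => x IHx s sn.
elim: (IH s sn) (sn) => {}s _ IHs {}sn.
constructor => -[|y t] [/eqP]; first by [].
rewrite eqSS => /eqP ts /= [yx|[-> lt_ts]].
  by apply: IHx => //; rewrite ts.
by apply: IHs => //; rewrite ts.
Qed.

End LexOrder.

(** The second half of [is_Cseq], isolated because it passes from C on D to [Csub] on [clb C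
    [:: z]]. Closure and order type of the underlying set are tracked separately. *)
Definition Cseq_axioms {d : Order.disp_t} {O : bOrderType d} (n : nat)
    (D : set O) (C : @Cseq d O) : Prop :=
  [/\ idx C `<=` incr_le D n, idx C [::], clb C [::] = D &
      forall (x : O) g, incr_le D n (x :: g) ->
        (idx C (x :: g) <-> idx C g /\ clb C g x) /\
        (idx C (x :: g) -> club (clb C (x :: g)) (below x `&` clb C g))].

(** * Deleting an entry of a sequence *)

Lemma del_subseq (T : eqType) i (s : seq T) : subseq (del i s) s.
Proof.
rewrite /del -{3}(cat_take_drop i s) cat_subseq //.
by rewrite -add1n -drop_drop drop_subseq.
Qed.

Lemma size_del (T : Type) i (s : seq T) : (i < size s)%N -> size (del i s) = (size s).-1.
Proof. by move=> si; rewrite size_cat size_take size_drop si; lia. Qed.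

Lemma del_cons (T : Type) i x (s : seq T) : del i.+1 (x :: s) = x :: del i s.
Proof. by []. Qed.

Lemma del_rcons (T : Type) i (s : seq T) x :
  (i < size s)%N -> del i (rcons s x) = rcons (del i s) x.
Proof.
move=> si; rewrite /del -!cats1 take_cat si drop_cat.
case: ltnP => [_|h]; first by rewrite catA.
have -> : i.+1 = size s by apply/eqP; rewrite eqn_leq si h.
by rewrite subnn drop0 drop_size cats0.
Qed.

Lemma del_rcons_last (T : Type) (s : seq T) x : del (size s) (rcons s x) = s.
Proof.
by rewrite /del -cats1 take_size_cat // drop_oversize ?cats0 // size_cat addn1.
Qed.

(** Closed form of the enumeration of removable positions in [child]: [bump j] skips the new entry,
    and the successor appears because position 0 is never removed. *)
Lemma nth_rem_iota i j n : (j < n)%N -> (i < n)%N ->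
  nth 0%N (rem j.+1 (iota 1 n.+1)) i = (bump j i).+1.
Proof.
move=> jn lin; have -> : iota 1 n.+1 = iota 1 j ++ j.+1 :: iota j.+2 (n - j).
  by rewrite (_ : n.+1 = j + (n - j).+1)%N ?iotaD ?add1n //; lia.
rewrite remE index_cat mem_iota ltnn andbF /= eqxx size_iota addn0.
rewrite take_size_cat ?size_iota // drop_cat size_iota ltnNge leqnSn /=.
rewrite subSn // subnn /= drop0 nth_cat size_iota /bump.
by case: ltnP => ij; rewrite nth_iota; lia.
Qed.

(** * C-sequences: indices, single steps and termination of walks *)

Section CSequenceLemmas.
Context {d : Order.disp_t} {O : bOrderType d} (hO : ordinals_like O).
Context (n : nat) (D : set O) (C : @Cseq d O) (hn : (0 < n)%N).
Hypothesis axC : Cseq_axioms n D C.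
Implicit Types (a x y : O) (b g s t : seq O).

Lemma idx_cons x g : idx C (x :: g) ->
  [/\ idx C g, clb C g x & club (clb C (x :: g)) (below x `&` clb C g)].
Proof.
case: axC => sub _ _ /(_ x g) ax xg; have [e cl] := ax (sub _ xg).
by case: (e.1 xg) => ? ?; split=> //; exact: cl.
Qed.

Lemma idx_suffix s t : idx C (s ++ t) -> idx C t.
Proof. by elim: s => //= x s IH /idx_cons[/IH]. Qed.

Lemma clb_suffix s t : idx C (s ++ t) -> clb C (s ++ t) `<=` clb C t.
Proof.
elim: s => [_|x s IH] /=; first exact: subset_refl.
by move=> /idx_cons[/IH sub _ [le _ _]] y /le[_]; exact: sub.
Qed.

Lemma clb_sub g : idx C g -> clb C g `<=` D.
Proof.
case: axC => _ _ CD _ gC; have := @clb_suffix g [::].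
by rewrite cats0 CD; apply.
Qed.

Lemma clb_lt x g y : idx C (x :: g) -> clb C (x :: g) y -> y < x.
Proof. by move=> /idx_cons[_ _ [le _ _]] /le[]. Qed.

Lemma idx_mem s t x : idx C (s ++ t) -> x \in s -> clb C t x.
Proof.
elim: s => //= y s IH /idx_cons[st sty _]; rewrite inE => /predU1P[->|].
  exact: clb_suffix sty.
exact: IH.
Qed.

Lemma idx_extend x g : idx C g -> (size g < n)%N -> clb C g x -> idx C (x :: g).
Proof.
move=> gC gn gx; have [sub _ _ ax] := axC.
suff inc : incr_le D n (x :: g) by apply/(ax x g inc).1.
have [gs _ gD] := sub _ gC; split=> //=.
  by case: g gC gx gs {gn gD} => //= y g gC gx ->; rewrite (clb_lt gC gx).
by move=> y; rewrite inE => /predU1P[->|/gD//]; exact: (clb_sub gC).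
Qed.

Lemma idx_single x : D x -> idx C [:: x].
Proof. by have [_ C0 CD _] := axC => Dx; apply: idx_extend => //; rewrite CD. Qed.

Lemma iota_sizeP b i : (i <= size b)%N -> idx C (drop i b) ->
  [/\ (iota_size C b <= i)%N, idx C (drop (iota_size C b) b) &
      forall k, (k < iota_size C b)%N -> ~ idx C (drop k b)].
Proof.
move=> ib ibC; rewrite /iota_size; set p := fun i => _.
have hp : has p (iota 0 (size b).+1).
  by apply/hasP; exists i; [rewrite mem_iota ltnS|exact/asboolP].
have before k : (k < find p (iota 0 (size b).+1))%N -> ~ idx C (drop k b).
  move=> kf; have := before_find 0%N kf; rewrite nth_iota ?add0n.
    by move=> /asboolP.
  by apply: leq_trans kf _; rewrite -[leqRHS](size_iota 0) find_size.
split=> //.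
  by rewrite leqNgt; apply/negP => /before.
have := nth_find 0%N hp; rewrite nth_iota ?add0n; first by move/asboolP.
by move: hp; rewrite has_find size_iota.
Qed.

(** Here iota is a :: g1 and tau is t. The entry a lies in iota because indices have length at most
    n; tau is nonempty because every one-entry sequence from D is an index. The last clause is the
    maximality of tau. *)
Lemma walk_decomposition a g : incr D n g ->
  exists g1 t, [/\ g = g1 ++ t, iota_size C (a :: g) = (size g1).+1, idx C t,
    t <> [::] & g1 <> [::] -> ~ idx C (last a g1 :: t)].
Proof.
move=> [gs gn gD].
have dn : idx C (drop n (a :: g)).
  case/lastP: g gn gs gD => [|g y]; first by move: hn => /[swap] <-.
  rewrite size_rcons => <- _ gD /=.
  by rewrite -cats1 drop_size_cat //; apply/idx_single/gD; rewrite mem_rcons mem_head.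
have [|le idt before] := iota_sizeP _ dn; first by rewrite /= gn.
set k := iota_size C (a :: g) in le idt before *.
have k0 : (0 < k)%N.
  rewrite lt0n; apply/eqP => k0; move: idt; rewrite k0 drop0.
  by have [sub _ _ _] := axC => /sub[_]; rewrite /= gn ltnn.
case: k k0 => // k _ in le idt before *.
exists (take k g), (drop k g); split=> //.
- by rewrite cat_take_drop.
- by rewrite size_take gn le.
- by move/(congr1 size); rewrite size_drop gn /=; lia.
- case: k => [|k] in le idt before *; first by rewrite take0.
  move=> _ idl; apply: (before k.+1) => //=.
  rewrite (drop_nth a); last by rewrite gn; lia.
  suff <- : last a (take k.+1 g) = nth a g k by [].
  by rewrite (take_nth a) ?last_rcons // gn; lia.
Qed.

(** Only the entries after the first are constrained: a is arbitrary and is never removed, while the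
    others stay strictly increasing in D along the walk. *)
Definition walk_label (l : nat * seq O) : Prop :=
  exists a g, l.2 = a :: g /\ incr D n g.

(** The new entry x is at least the last entry of iota. For nonempty g1 equality is impossible,
    since that entry could then be added to tau; hence g1 ++ x :: t is strictly increasing. As
    [bump] skips the position of x, the new entry survives the step. *)
Lemma child_spec m a g i l : incr D n g -> child n C (m, a :: g) i = Some l ->
  (i < n)%N /\ exists g1 x t,
  [/\ g = g1 ++ t, idx C t /\ t <> [::], clb C t x /\ sorted <%O (g1 ++ x :: t),
      (g1 <> [::] -> idx C (x :: t)) /\ iota_size C (a :: g) = (size g1).+1
    & l = ((m + size g1 + (bump (size g1) i).+1)%N,
           a :: del (bump (size g1) i) (g1 ++ x :: t))].
Proof.
move=> gD; have [g1 [t [gE kE tC t0 nC]]] := walk_decomposition a gD.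
rewrite /child kE; case: ifPn => //; rewrite negb_or => /andP[/asboolPn A0].
rewrite -ltnNge => lin [<-]; split=> //.
have {A0} /set0P[y Ay] : (clb C (drop (size g1).+1 (a :: g)) `\`
  below (nth \bot (a :: g) (size g1)))%classic != set0 by apply/eqP.
have [] := ominP hO Ay; set x := omin _; clearbody x.
rewrite [drop _ _]/= gE drop_size_cat // => -[xt xge] _ {y Ay}.
have {}xge : last a g1 <= x.
  suff <- : nth \bot (a :: g1 ++ t) (size g1) = last a g1.
    by rewrite leNgt; apply/negP.
  by rewrite -cat_cons nth_cat /= ltnS leqnn (last_nth \bot).
have tn : (size t <= n)%N by have [sub _ _ _] := axC; case: (sub _ tC).
have gn : size (g1 ++ t) = n by rewrite -gE; case: gD.
have tn' : g1 <> [::] -> (size t < n)%N.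
  by case: (g1) gn => //= z s <- _; rewrite size_cat; lia.
have xC : (size t < n)%N -> idx C (x :: t) by move=> ?; exact: idx_extend.
have st : sorted <%O (g1 ++ t) by rewrite -gE; case: gD.
have li : nth 0%N (rem (size g1).+1 (iota 1 n.+1)) i = (bump (size g1) i).+1.
  by rewrite nth_rem_iota // -gn size_cat; case: (t) t0 => //= *; lia.
exists g1, x, t; split=> //; last 2 first.
- by split=> // /tn'.
- by rewrite li del_cons take_size_cat.
  clear li; split=> //.
  have xst : sorted <%O (x :: t).
    have [sub _ _ _] := axC; have [ts _ _] := sub _ tC.
    case: (t) t0 tC xt ts => //= z s _ zsC xz ->.
    by rewrite (clb_lt zsC xz).
  case/lastP: g1 => [//|s z] in st xge tn' nC gE kE gn *.
  have ne : rcons s z <> [::] by case: (s).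
  move: st; rewrite !cat_rcons !sorted_cat_cons => /andP[-> _] /=.
  rewrite -/(sorted _ (x :: t)) xst andbT lt_neqAle.
  move: xge nC; rewrite last_rcons => -> nC; rewrite andbT.
  by apply/eqP => zx; apply: (nC ne); rewrite zx; exact/xC/tn'.
Qed.

Lemma child_walk_label l i l' :
  walk_label l -> child n C l i = Some l' -> walk_label l'.
Proof.
case: l => m b [a [g [/= -> gD]]].
move=> /(child_spec gD)[lin [g1 [x [t [gE [tC _] [xt st] _ ->]]]]].
case: gD; rewrite gE => _ gn gD.
exists a, (del (bump (size g1) i) (g1 ++ x :: t)); split=> //; split.
- exact: (subseq_sorted lt_trans (del_subseq _ _) st).
- have sz : size (g1 ++ x :: t) = n.+1 by rewrite size_cat /= addnS -size_cat gn.
  by rewrite size_del sz //= /bump; lia.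
- move=> y /(mem_subseq (del_subseq _ _)); rewrite mem_cat inE.
  rewrite orbCA => /predU1P[->|]; first exact: clb_sub xt.
  by rewrite -mem_cat; exact: gD.
Qed.

(** The new entry lies below the first entry of t, which already occurs in g. Hence a largest entry,
    once removed, never returns. *)
Lemma child_lt m a g i l' c : incr D n g -> child n C (m, a :: g) i = Some l' ->
  (forall y, y \in g -> y < c) -> forall y, y \in behead l'.2 -> y < c.
Proof.
move=> gD /(child_spec gD)[_ [g1 [x [t [gE [tC t0] [xt _] _ ->]]]]] gc y /=.
move=> /(mem_subseq (del_subseq _ _)); rewrite mem_cat inE orbCA.
rewrite -mem_cat -gE => /predU1P[->|]; last exact: gc.
case: t t0 tC xt gE => //= z t _ zC xz gE; apply: lt_trans (clb_lt zC xz) _.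
by apply: gc; rewrite gE mem_cat mem_head orbT.
Qed.

(* Read backwards, with [e] standing for every entry outside tau, labels
   decrease lexicographically along the walk.  (Removing an entry of tau may
   leave a sequence outside [idx C], but never disturbs the later entries.) *)
Definition walk_code (e : O) (b : seq O) : seq O :=
  let t := drop (iota_size C b) b in rev t ++ nseq (n - size t) e.

Lemma size_walk_code e a g : incr D n g -> size (walk_code e (a :: g)) = n.
Proof.
move=> /(walk_decomposition a)[g1 [t [gE kE tC _ _]]].
rewrite /walk_code kE gE /= drop_size_cat // size_cat size_rev size_nseq.
by have [sub _ _ _] := axC; have [_ tn _] := sub _ tC; rewrite subnKC.
Qed.

(** A final segment that is an index is contained in tau, so the reversed tau starts with its
    reversal. *)
Lemma walk_code_suffix e s t : idx C t -> exists w, walk_code e (s ++ t) = rev t ++ w.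
Proof.
move=> tC; rewrite /walk_code.
have [||le _ _] := @iota_sizeP (s ++ t) (size s); rewrite ?size_cat ?leq_addr //.
  by rewrite drop_size_cat.
set k := iota_size C (s ++ t) in le *.
have -> : drop k (s ++ t) = drop k s ++ t.
  rewrite drop_cat; move: le; rewrite leq_eqVlt => /predU1P[->|-> //].
  by rewrite ltnn subnn drop0 drop_size.
by eexists; rewrite rev_cat -catA.
Qed.

Lemma child_decreasing e l i l' : D `<=` below e ->
  walk_label l -> child n C l i = Some l' ->
  lex_lt (walk_code e l'.2) (walk_code e l.2).
Proof.
move=> De; case: l => m b [a [g [/= -> gD]]] ch.
have gn : size g = n by case: gD.
move: ch => /(child_spec gD)[lin [g1 [x [t [gE [tC t0] [xt st] [xtC kE] ->]]]]] /=.
have -> : walk_code e (a :: g) = rev t ++ nseq (size g1) e.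
  rewrite /walk_code kE gE /= drop_size_cat //; congr (_ ++ nseq _ _).
  by rewrite -gn gE size_cat addnK.
(* Either an entry of t is removed, at position p of t, or an entry of g1. *)
rewrite /bump; case: leqP => ij.
  pose p := (i - size g1)%N; have pt : (p < size t)%N.
    by rewrite /p; move: lin; rewrite -gn gE size_cat; lia.
  have -> : del (1 + i) (g1 ++ x :: t) = (g1 ++ x :: del p t)%SEQ.
    rewrite /del !take_cat !drop_cat /= ltnNge leqW // ltnNge !leqW //=.
    rewrite [in RHS]/p (_ : (1 + i - size g1 = p.+1)%N)
      1?(_ : (i.+2 - size g1 = p.+2)%N) //=; last 2 first.
    - by rewrite /p; lia.
    - by rewrite /p; lia.
    by rewrite -catA.
  have tE : t = take p t ++ nth x t p :: drop p.+1 t.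
    by rewrite -drop_nth // cat_take_drop.
  set y := nth x t p in tE; set t1 := take p t in tE; set t2 := drop p.+1 t in tE.
  rewrite /del -/t1 -/t2 tE in tC xt *.
  have yC : idx C (y :: t2) by exact: idx_suffix tC.
  have [t2C _ [y_sub _ _]] := idx_cons yC.
  (* z is the entry just before the removed y. It lies in the club indexed by y :: t2, so z < y and
     z :: t2 is an index: after the common part [rev t2], the code has z in place of y. *)
  case/lastP E: (x :: t1) => [//|u z].
  have zy : clb C (y :: t2) z.
    have : z \in x :: t1 by rewrite E mem_rcons mem_head.
    rewrite inE => /predU1P[->|]; first exact: clb_suffix tC _ xt.
    exact: idx_mem tC.
  have [_ y2n _] : incr_le D n (y :: t2) by have [sub _ _ _] := axC; exact: sub.
  have zC : idx C (z :: t2) by apply: idx_extend => //; have [] := y_sub _ zy.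
  have -> : a :: g1 ++ x :: t1 ++ t2 = ((a :: g1) ++ u) ++ z :: t2.
    by rewrite -cat_cons -[x :: _]cat_cons E cat_rcons catA.
  have [w ->] := walk_code_suffix e ((a :: g1) ++ u) zC.
  rewrite rev_cat !rev_cons !cat_rcons -!catA.
  by apply: lex_lt_cat; exact: clb_lt zy.
(* When an entry of g1 is removed, x :: t is an index, so x < e takes the place of the first padding
   entry e. *)
have g10 : g1 <> [::] by case: (g1) ij.
have -> : a :: del (0 + i) (g1 ++ x :: t) = (a :: del i g1) ++ x :: t.
  rewrite /del take_cat drop_cat ij cat_cons -catA; congr (_ :: _ ++ _).
  rewrite ltn_neqAle ij andbT; case: eqP => // ->.
  by rewrite subnn drop0 drop_size.
have [w ->] := walk_code_suffix e (a :: del i g1) (xtC g10).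
rewrite rev_cons cat_rcons; case: (g1) g10 => //= *; apply: lex_lt_cat.
exact/De/(clb_sub tC).
Qed.

Definition walk_sum : nat * seq O -> {freeg (seq O)} :=
  tree_sum (child n C) (fun l => contribution l).

Lemma walk_rE a g : walk_r n C a g = walk_sum (0%N, a :: g).
Proof. by []. Qed.

Lemma walk_label_ind (e : O) (P : nat * seq O -> Prop) : D `<=` below e ->
  (forall l, walk_label l ->
     (forall i l', child n C l i = Some l' -> P l') -> P l) ->
  forall l, walk_label l -> P l.
Proof.
move=> De IH l lD.
have sz l' : walk_label l' -> size (walk_code e l'.2) = n.
  by move=> [a [g [-> gD]]]; exact: size_walk_code.
move sE : (walk_code e l.2) => s.
have ac : Acc (fun s t => size s = size t /\ lex_lt s t) s.
  by apply: (lex_lt_wf hO (n := n)); rewrite -sE; exact: sz.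
elim: ac l lD sE => {}s _ IHs l lD sE; apply: IH => // i l' ch.
have l'D := child_walk_label lD ch.
apply: IHs erefl => //; rewrite -sE; split; first by rewrite !sz.
exact: child_decreasing ch.
Qed.

(** Walks terminate and branch finitely, so all their trees are finite by [walk_label_ind], and
    [tree_sum_rec] applies. *)
Lemma walk_sum_rec e l : D `<=` below e -> walk_label l ->
  (walk_sum l = contribution l + \sum_(i < n) oapp walk_sum 0 (child n C l i))%R.
Proof.
move=> De lD.
have child_None l' i : (n <= i)%N -> child n C l' i = None.
  by case: l' => m b ni; rewrite /child ni orbT.
suff fin : forall l', walk_label l' -> finite_set (nodes_from (child n C) l').
  apply: (tree_sum_rec _ (child_None l) _).2 => i l'.
  by move=> /(child_walk_label lD); exact: fin.
apply: (walk_label_ind De) => l' l'D IH.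
exact: (tree_sum_rec (fun l => contribution l) (child_None l') IH).1.
Qed.

(** Serves twice: with phi a coefficient, to locate the support of the walk sums, and with phi =
    [last_part z], to discard the subtree in which z has been removed. *)
Lemma walk_sum_vanish e (M : zmodType) (phi : {additive {freeg (seq O)} -> M})
    (P : nat * seq O -> Prop) : D `<=` below e ->
  (forall l, walk_label l -> P l -> phi (contribution l) = 0%R) ->
  (forall l i l', walk_label l -> P l -> child n C l i = Some l' -> P l') ->
  forall l, walk_label l -> P l -> phi (walk_sum l) = 0%R.
Proof.
move=> De Pphi Pchild.
apply: (walk_label_ind De) => l lD IH Pl.
rewrite (walk_sum_rec De lD) raddfD /= Pphi // add0r raddf_sum big1 // => i _.
case E: (child n C l i) => [l'|] /=; last exact: raddf0.
by apply: (IH _ _ E); exact: Pchild E.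
Qed.

End CSequenceLemmas.

Lemma lt_sorted_rcons {d : Order.disp_t} {O : porderType d} (s : seq O) z y :
  sorted <%O (rcons s z) -> y \in s -> y < z.
Proof.
rewrite lt_sorted_pairwise pairwise_rcons => /andP[+ _] ys.
by move=> /allP /(_ _ ys).
Qed.


(** * Projecting walks along C to walks along C^z *)

Section Projection.
Context {d : Order.disp_t} {O : bOrderType d} (hO : ordinals_like O).
Implicit Types (C : @Cseq d O) (D : set O).

(* Keeps the basis elements ending with [z] and erases this last entry. *)
Definition last_part (z : O) : {freeg (seq O)} -> {freeg (seq O)} :=
  fglift (fun e : seq O => if e == rcons (take (size e).-1 e) z
                           then << take (size e).-1 e >> else 0%R).

HB.instance Definition _ z :=
  GRing.isAdditive.Build _ _ (last_part z) (lift_is_additive _).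

Lemma last_partU z (c : int) e :
  last_part z << c *g rcons e z >> = << c *g e >>.
Proof.
rewrite /last_part liftU size_rcons /= -cats1 take_size_cat // cats1 eqxx.
by apply/eqP/freeg_eqP => k; rewrite coeffZ !coeffU mul1r.
Qed.

Lemma last_partU0 z (c : int) (e : seq O) : z \notin e ->
  last_part z << c *g e >> = 0%R.
Proof.
move=> ze; rewrite /last_part liftU; case: eqP => [eE|_]; last by rewrite scaler0.
by move: ze; rewrite eE mem_rcons mem_head.
Qed.

Lemma last_part_eq0 z h : (forall e, rcons e z \notin dom h) -> last_part z h = 0%R.
Proof.
move=> nh; rewrite -[h]freeg_sumE raddf_sum big_seq big1 //= => k kh.
rewrite /last_part liftU; case: eqP => [kE|_]; last by rewrite scaler0.
by move: (nh (take (size k).-1 k)); rewrite -kE kh.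
Qed.

Lemma Csub_axioms m D C z : (0 < m)%N -> Cseq_axioms m.+1 D C -> D z ->
  Cseq_axioms m (clb C [:: z]) (Csub m.+1 C z).
Proof.
move=> m0 axC Dz; have zC := idx_single (ltn0Sn m) axC Dz.
split=> //=; first by move=> g [].
move=> x g [xgs xgm xgz]; rewrite /= in xgs xgm.
have gi : incr_le (clb C [:: z]) m g.
  split=> //; [exact: path_sorted xgs|exact: ltnW|].
  by move=> y yg; apply: xgz; rewrite inE yg orbT.
split; last by move=> [_ /(idx_cons axC)[]].
split=> [[_ /(idx_cons axC)[]]//|[[_ gC] gx]].
split=> //; apply: (idx_extend axC) => //.
by rewrite size_rcons.
Qed.

(** The point is that the clubs indexed by ⟨a, z⟩ and ⟨a⟩ coincide. Since a is a limit of a subset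
    of C_z, the club indexed by ⟨a, z⟩ has supremum a, and clause (ii) of coherence for C applies.
    Both clauses for C^z then follow from those for C. *)
Lemma Csub_coherent m D C z e : (0 < m)%N -> D `<=` below e ->
  Cseq_axioms m.+1 D C -> D z ->
  coherent m.+1 C -> coherent m (Csub m.+1 C z).
Proof.
move=> m0 De axC Dz coh a [az [g [[_ gC] gm aacc]]].
have zC := idx_single (ltn0Sn m) axC Dz; rewrite /= in az gC aacc.
have azC : idx C [:: a; z] by apply: (idx_extend axC).
have Da : D a by exact: (clb_sub axC zC).
have Xa : Xset m.+1 C a.
  by split; [case: axC => _ _ -> _|exists (rcons g z); rewrite size_rcons gm].
have [coh1 coh2] := coh a Xa.
have z_lt : clb C [:: z] `<=` below e by move=> y /(clb_sub axC zC)/De.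
have la : limpt (clb C [:: a; z]) a.
  have [_ _ azcl] := idx_cons axC azC.
  apply: (limpt_club hO z_lt azcl).
  have [_ /(accpE hO)[_]] := aacc; apply: limptS.
  by rewrite -cats1; apply: (clb_suffix axC); rewrite cats1.
have azE : clb C [:: a; z] = clb C [:: a].
  apply: coh2 => //; have [aE _] := (osup_limpt hO _ _).2 la.
  rewrite -[RHS]aE; congr osup; apply/seteqP.
  by split=> [y ya|y []//]; split=> //; exact: (clb_lt axC azC).
split=> [h [_ hC] hm ahacc|b [_ bC] bsup] /=.
  by rewrite azE; apply: coh1 => //; rewrite size_rcons hm.
by rewrite azE; exact: coh2.
Qed.

Lemma Csub_idx m D C z s : Cseq_axioms m.+1 D C ->
  idx C (rcons s z) -> idx (Csub m.+1 C z) s.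
Proof.
move=> axC sC; split=> //; have [sub _ _ _] := axC.
have [ss sm sD] := sub _ sC; split=> [||x xs].
- by apply: (subseq_sorted lt_trans) ss; rewrite -cats1 prefix_subseq.
- by rewrite size_rcons in sm.
- by apply: (idx_mem axC (s := s)) => //; rewrite cats1.
Qed.

(** A final segment is an index of C^z exactly when it becomes an index of C after z is appended, so
    tau is merely lengthened by z. *)
Lemma iota_size_rcons m D C z a g : (0 < m)%N -> Cseq_axioms m.+1 D C -> D z ->
  incr (clb C [:: z]) m g ->
  iota_size C (rcons (a :: g) z) = iota_size (Csub m.+1 C z) (a :: g).
Proof.
move=> m0 axC Dz gz; have axC' := Csub_axioms m0 axC Dz.
have [g1 [t [gE kE tC t0 _]]] := walk_decomposition m0 axC' a gz.
have kg : ((size g1).+1 <= size (a :: g))%N by rewrite gE /= size_cat ltnS leq_addr.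
have [|_ _ before'] := @iota_sizeP _ _ (Csub m.+1 C z) (a :: g) (size g1).+1 kg.
  by rewrite gE /= drop_size_cat.
have [||le kC _] := @iota_sizeP _ _ C (rcons (a :: g) z) (size g1).+1.
- by rewrite size_rcons leqW.
- by rewrite drop_rcons // gE /= drop_size_cat //; case: tC.
rewrite kE in before' *; apply/eqP; rewrite eqn_leq le leqNgt; apply/negP => lt.
apply: (before' _ lt); apply: (Csub_idx axC).
by rewrite -drop_rcons // (leq_trans le).
Qed.

(** For i < m the removed entry is not the last one, so z stays in place and both steps insert the
    same minimum. *)
Lemma child_rcons m D C z k a g i : (0 < m)%N -> Cseq_axioms m.+1 D C -> D z ->
  incr (clb C [:: z]) m g -> (i < m)%N ->
  child m.+1 C (k, rcons (a :: g) z) i =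
  omap (fun l => (l.1, rcons l.2 z)) (child m (Csub m.+1 C z) (k, a :: g) i).
Proof.
move=> m0 axC Dz gz im; have axC' := Csub_axioms m0 axC Dz.
have [g1 [t [gE kE tC t0 _]]] := walk_decomposition m0 axC' a gz.
have [_ gm _] := gz.
have gt : size g = (size g1 + size t)%N by rewrite gE size_cat.
have tpos : (0 < size t)%N by case: (t) t0.
have kE' := iota_size_rcons a m0 axC Dz gz.
have jE : (size g1).+1.-1 = size g1 by [].
have nthE : nth \bot (rcons (a :: g) z) (size g1) = nth \bot (a :: g) (size g1).
  by rewrite nth_rcons /= ltnS gt leq_addr.
have dropE : drop (size g1).+1 (rcons (a :: g) z) =
    rcons (drop (size g1).+1 (a :: g)) z.
  by rewrite drop_rcons //= gt ltnS leq_addr.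
have takeE : take (size g1).+1 (rcons (a :: g) z) = take (size g1).+1 (a :: g).
  by rewrite -cats1 takel_cat //= gt ltnS leq_addr.
rewrite /child kE' kE jE nthE dropE takeE.
rewrite [(m.+1 <= i)%N]leqNgt [(m <= i)%N]leqNgt leqW // im !orbF.
rewrite [clb (Csub _ _ _) _]/=; case: ifP => [//|_].
have bound (p : nat) : (m <= p)%N -> (size g1 < p)%N.
  by apply: leq_trans; rewrite -gm gt -addn1 leq_add2l.
rewrite !nth_rem_iota ?bound ?leqW //.
rewrite [RHS]/=; congr (Some (_, _)).
set x := omin _; rewrite -rcons_cons -rcons_cat del_rcons //.
rewrite size_cat size_take /= size_drop gt /bump; move: gm; rewrite gt.
by case: ifP; lia.
Qed.

Lemma incr_rcons m D C z g : Cseq_axioms m.+1 D C -> D z ->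
  incr (clb C [:: z]) m g -> incr D m.+1 (rcons g z).
Proof.
move=> axC Dz [gs gm gD]; have zC := idx_single (ltn0Sn m) axC Dz; split; last 2 first.
- by rewrite size_rcons gm.
- move=> y; rewrite mem_rcons inE => /predU1P[->//|/gD].
  exact: (clb_sub axC zC).
rewrite lt_sorted_pairwise pairwise_rcons -lt_sorted_pairwise gs andbT.
by apply/allP => y /gD; exact: (clb_lt axC zC).
Qed.

Lemma walk_sum_rcons m D C z e l : (0 < m)%N -> D `<=` below e ->
  Cseq_axioms m.+1 D C -> D z -> walk_label m (clb C [:: z]) l ->
  last_part z (walk_sum m.+1 C (l.1, rcons l.2 z)) =
  walk_sum m (Csub m.+1 C z) l.
Proof.
move=> m0 De axC Dz; have axC' := Csub_axioms m0 axC Dz.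
have zC := idx_single (ltn0Sn m) axC Dz.
have ze : clb C [:: z] `<=` below e by move=> y /(clb_sub axC zC)/De.
move: l; apply: (walk_label_ind hO m0 axC' ze) => -[k b] lz IH.
have [a [g [/= bE gz]]] := lz; have [gs gm gD] := gz.
have gzD := incr_rcons axC Dz gz.
have lzD : walk_label m.+1 D (k, rcons b z) by exists a, (rcons g z); rewrite bE.
rewrite (walk_sum_rec hO (ltn0Sn m) axC De lzD) (walk_sum_rec hO m0 axC' ze lz).
rewrite raddfD raddf_sum big_ord_recr /=; congr (_ + _)%R.
  (* As m > 0, dropping the first two entries leaves z in place, and [last_part] just erases it. *)
  rewrite /contribution /= drop_rcons ?last_partU // bE /= gm.
  exact: m0.
(* The remaining child, of index m, is the one that removes z. From there on all entries after the
   first are below z, so [last_part z] kills every contribution. *)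
rewrite [X in (_ + X)%R](_ : _ = 0%R) ?addr0; last first.
  case E: (child m.+1 C (k, rcons b z) m) => [[k' b']|] /=; last by rewrite raddf0.
  pose P (l : nat * seq O) := forall y, y \in behead l.2 -> y < z.
  apply: (walk_sum_vanish hO (ltn0Sn m) axC (P := P) De) => [[k1 b1]|[k1 b1] i l'||].
  - move=> [a1 [g1 [/= -> _]]] P1; rewrite /contribution /= last_partU0 //.
    apply/negP => zg; have := P1 z; rewrite ltxx => /(_ _)/notF; apply => /=.
    exact: mem_drop zg.
  - by move=> [a1 [g1 [/= -> g1D]]] P1 /(child_lt hO (ltn0Sn m) axC g1D); apply.
  - exact: (child_walk_label hO (ltn0Sn m) axC lzD E).
  move: E; rewrite bE rcons_cons => /(child_spec hO (ltn0Sn m) axC gzD).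
  move=> [_ [h [x [t [gE [_ t0] [_ st] _ [_ ->]]]]]] y /=.
  have sz : size (rcons g z) = (size h + size t)%N by rewrite gE size_cat.
  have tpos : (0 < size t)%N by case: (t) t0.
  rewrite size_rcons gm in sz.
  case/lastP: t t0 gE st sz tpos => // t w _ gE st sz _.
  have {}gE : w = z.
    by move: gE; rewrite -rcons_cat => /rcons_inj[].
  rewrite -rcons_cons -rcons_cat gE in st *.
  have -> : bump (size h) m = size (h ++ x :: t).
    by move: sz; rewrite size_rcons size_cat /= /bump; lia.
  rewrite del_rcons_last => yh; exact: lt_sorted_rcons st yh.
apply: eq_bigr => i _; rewrite bE (child_rcons k a m0 axC Dz gz) //.
case E: (child m _ _ i) => [l'|] /=; last exact: raddf0.
by apply: (IH i); rewrite bE.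
Qed.

End Projection.

(** * The case n = 1: walk lengths and threads *)

Section BaseCase.
Context {d : Order.disp_t} {O : bOrderType d} (hO : ordinals_like O).
Context (D : set O) (C : @Cseq d O) (e : O).
Hypotheses (De : D `<=` below e) (axC : Cseq_axioms 1 D C).

(** For n = 1 all contributions are multiples of the basis element of the empty sequence, and m
    grows by 2 at each step. So for even m and g in D this counts the nodes of the walk from g to
    a. *)
Definition walk_length (m : nat) (a g : O) : int :=
  coeff [::] (walk_sum 1 C (m, [:: a; g])).

Lemma incr_single g : D g -> incr D 1 [:: g].
Proof. by move=> Dg; split=> // x; rewrite inE => /eqP ->. Qed.

Lemma child_one m a g : D g -> child 1 C (m, [:: a; g]) 0 =
  let A := (clb C [:: g] `\` below a)%classic in
  if `[< A = set0 >] then None else Some (m.+2, [:: a; omin A]).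
Proof.
move=> Dg; have [g1 [t [gE kE _ t0 _]]] :=
  walk_decomposition (ltn0Sn 0) axC a (incr_single Dg).
have {}kE : iota_size C [:: a; g] = 1%N.
  rewrite kE; case: g1 gE {kE} => //= x [|y g1] []; last by case: g1.
  by case: (t) t0.
rewrite /child kE /= orbF; case: ifP => // _.
by rewrite addn0 addn2.
Qed.

Lemma walk_length_rec m a g : D g ->
  let A := (clb C [:: g] `\` below a)%classic in
  walk_length m a g = ((-1) ^+ m +
    (if `[< A = set0 >] then 0 else walk_length m.+2 a (omin A)))%R.
Proof.
move=> Dg A; rewrite /walk_length.
have lD : walk_label 1 D (m, [:: a; g]).
  by exists a, [:: g]; split=> //; exact: incr_single.
rewrite (walk_sum_rec hO (ltn0Sn 0) axC De lD) raddfD /= coeffU eqxx mulr1.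
rewrite big_ord_recl big_ord0 addr0 child_one //= -/A.
by case: ifP => //= _; rewrite coeff0.
Qed.

Lemma club_diff_nonempty a g : D a -> D g -> a < g ->
  (clb C [:: g] `\` below a)%classic !=set0.
Proof.
move=> Da Dg ag; have gC := idx_single (ltn0Sn 0) axC Dg.
have [_ _ cl] := idx_cons axC gC; have [_ _ CD _] := axC.
have sub : below g `&` clb C [::] `<=` below e by move=> y [_]; rewrite CD => /De.
have [|y Cy ay] := club_cofinal hO sub cl (x := a); first by rewrite CD.
by exists y; split=> //; apply/negP; rewrite -leNgt.
Qed.

Lemma walk_length_ge1 m a g : D g -> ~~ odd m -> (1 <= walk_length m a g)%R.
Proof.
move=> Dg modd; pose P (l : nat * seq O) := forall m a g,
  l = (m, [:: a; g]) -> D g -> ~~ odd m -> (1 <= walk_length m a g)%R.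
suff : P (m, [:: a; g]) by apply.
apply: (walk_label_ind hO (ltn0Sn 0) axC De (P := P)) => [l _ IH|]; last first.
  by exists a, [:: g]; split=> //; exact: incr_single.
move=> {modd Dg m a g} m a g lE Dg modd.
rewrite walk_length_rec // -signr_odd (negPf modd) expr0 lerDl.
case: ifPn => // /asboolPn/eqP/set0P[y Ay].
apply: le_trans (IH 0%N _ _ _ _ _ erefl _ _); rewrite ?lE ?child_one //=.
- case: ifP => // /asboolP A0; by move: Ay; rewrite A0.
- have [[/(clb_sub axC (idx_single (ltn0Sn 0) axC Dg)) //]] := ominP hO Ay.
- by rewrite negbK.
Qed.

(** The second node is x = min(C_g minus a), and the walk stops there exactly when x = a: C_a has
    nothing above a, whereas for x > a the club C_x is cofinal in the part of D below x, which
    contains a. *)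
Lemma walk_length_eq2 a g : D a -> D g -> a < g ->
  walk_length 0 a g = 2%:R%R <-> clb C [:: g] a.
Proof.
move=> Da Dg ag; have gC := idx_single (ltn0Sn 0) axC Dg.
have [y Ay] := club_diff_nonempty Da Dg ag.
have [[xC xa] xmin] := ominP hO Ay.
have Dx := clb_sub axC gC xC.
rewrite walk_length_rec //=; case: ifP => [/asboolP A0|_].
  by move: Ay; rewrite A0.
set x := omin _ in xC xa xmin Dx *.
rewrite walk_length_rec //=; split=> [|aC].
  case: ifPn => [/asboolP A0 _|An h].
    move: xa => /negP; rewrite -leNgt le_eqVlt => /predU1P[->//|ax].
    by have [z] := club_diff_nonempty Da Dx ax; rewrite A0.
  move/asboolPn/eqP/set0P: An => [z Az].
  have [[/(clb_sub axC (idx_single (ltn0Sn 0) axC Dx)) Dz _] _] := ominP hO Az.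
  (* After two steps m is 4; a third node makes the length at least 3. *)
  have := @walk_length_ge1 4 a _ Dz isT; move: h.
  by rewrite expr0 (_ : (-1) ^+ 2 = 1 :> int)%R //; lia.
have xE : x = a.
  apply/eqP; rewrite eq_le xmin /=; last by split=> //; rewrite /below /= ltxx.
  by rewrite leNgt; apply/negP.
case: ifPn => // /asboolPn[]; rewrite xE; apply/seteqP; split=> // z [zC []].
exact: (clb_lt axC (idx_single (ltn0Sn 0) axC Da) zC).
Qed.

Hypotheses (cD : accp D `<=` D) (rD : regular_set D).

(** A form of Fodor's lemma. Otherwise, for each eta and c, the points g with [tail eta c g] have a
    bound B (eta, c) in D, and since [int] is countable some G eta bounds these over all c. At a
    closure point g of G, the eta < g chosen for g gives g <= G eta < g. *)
Lemma pressing_down (tail : O -> int -> O -> Prop) :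
  (forall g, D g -> limpt D g -> exists eta c, [/\ D eta, eta < g & tail eta c g]) ->
  exists eta c, D eta /\
    forall b, D b -> exists g, [/\ D g, limpt D g, b < g & tail eta c g].
Proof.
move=> tailP; apply: contrapT => nex.
have /choice[B BP] : forall p : O * int, exists b, D b /\ (D p.1 ->
    forall g, D g -> limpt D g -> tail p.1 p.2 g -> g <= b).
  move=> [eta c] /=; have [De'|] := pselect (D eta); last first.
    by have [[x Dx] _ _ _] := rD; exists x.
  apply: contrapT => nb; apply: nex; exists eta, c; split=> // b Db.
  apply: contrapT => ng; apply: nb; exists b; split=> // _ g Dg lg tg.
  by rewrite leNgt; apply/negP => bg; apply: ng; exists g.
have [_ _ _ Dom] := rD.
have /choice[G GP] : forall eta, exists b, D b /\ forall c, B (eta, c) <= b.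
  move=> eta; have [i|b Db bP] := Dom (fun i => B (eta, odflt 0%R (unpickle i))).
    by case: (BP (eta, odflt 0%R (unpickle i))).
  by exists b; split=> // c; have := bP (pickle c); rewrite pickleK.
have [x0 Dx0] : D !=set0 by case: rD.
have [g [Dg lg gP] _] :=
  closure_points_cofinal hO De cD rD (fun x _ => (GP x).1) Dx0.
have [eta [c [Deta eta_g tg]]] := tailP g Dg lg.
have gB := (BP (eta, c)).2 Deta g Dg lg tg.
have := le_trans gB ((GP eta).2 c).
by rewrite leNgt gP.
Qed.

Definition extend_Cseq (dl : O) (E : set O) : @Cseq d O :=
  MkCseq (idx C `|` [set [:: dl]])%classic
    (fun g => if g == [::] then (D `|` [set dl])%classic
              else if g == [:: dl] then E else clb C g).

(** E is a thread through C: placed at the new top point [ssup D], it extends C coherently. *)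
Lemma extension_not_nontrivial (E : set O) : infinite_set D -> coherent 1 C ->
  E `<=` D -> (forall x, D x -> exists2 y, E y & x <= y) ->
  (forall a, a < ssup D -> limpt E a ->
     exists g, [/\ D g, a < g, limpt D g & clb C [:: g] = (E `&` below g)%classic]) ->
  ~ nontrivial 1 C.
Proof.
move=> infD coh ED cofE locE; rewrite /nontrivial.
have [sub C0 CD ax] := axC; rewrite CD; set dl := ssup D.
have D_dl x : D x -> x < dl by exact: (lt_ssup hO De).
have dl_D : ~ D dl by move=> /D_dl; rewrite ltxx.
move=> ncl; apply: ncl; exists (extend_Cseq dl E).
have EDe : E `<=` below e by move=> x /ED/De.
have sE : ssup E = dl by exact: (cofinal_ssup hO De ED cofE).
have idl : ~ idx C [:: dl].
  by move=> /sub[_ _ /(_ dl)]; rewrite mem_head => /(_ isT).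
have clbE g : idx C g -> g <> [::] -> clb (extend_Cseq dl E) g = clb C g.
  move=> gC /eqP/negPf g0 /=; rewrite g0; case: eqP => // gE.
  by case: idl; rewrite -gE.
have idx_single' x : idx (extend_Cseq dl E) [:: x] -> D x \/ x = dl.
  by case=> [/sub[_ _ /(_ x)]|[->]]; [rewrite mem_head => xD; left; exact: xD|right].
have D1e : (D `|` [set dl])%classic `<=` below (osucc dl).
  move=> x [/D_dl xd|->]; rewrite /below /=; last exact: lt_osucc.
  by rewrite (lt_osuccE hO) ltW.
have lim_cut g a : a < g -> limpt E a -> limpt (E `&` below g)%classic a.
  move=> ag [a0 la]; split=> // x /la[y [Ey xy ya]].
  by exists y; split=> //; split=> //; exact: lt_trans ya ag.
(* A limit a of E below dl is a limit of some C_g = E ∩ g with g > a. Hence a belongs to C_g, and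
   coherence of C gives E ∩ a = C_g ∩ a = C_a. This yields both the closure of E and coherence at
   dl. *)
have EE a : a < dl -> limpt E a -> E a /\ acc E a /\
    (E `&` below a)%classic = clb C [:: a].
  move=> adl la; have [g [Dg ag lg gE]] := locE a adl la.
  have gC := idx_single (ltn0Sn 0) axC Dg.
  have [_ _ cl] := idx_cons axC gC.
  have lga : limpt (clb C [:: g]) a by rewrite gE; exact: lim_cut.
  have gsub : below g `&` clb C [::] `<=` below e by move=> y [_]; rewrite CD => /De.
  have Da : D a.
    by apply: cD; apply/(accpE hO); split=> //; exact: limptS ED la.
  have aC : clb C [:: g] a.
    have ga : (below g `&` clb C [::])%classic a by rewrite CD.
    exact: (club_limpt hO gsub cl ga lga).
  have Ea : E a by move: aC; rewrite gE => -[].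
  have accga : acc (clb C [:: g]) a.
    split=> //; apply/(accpE hO); split=> //.
    by apply: (lt_ssup hO (b := e) _ aC) => y /(clb_sub axC gC)/De.
  split=> //; split; first by split=> //; apply/(accpE hO); rewrite sE.
  have [|/(_ [:: g] gC erefl accga) <- _] := coh a.
    by split; [rewrite CD|exists [:: g]].
  rewrite gE; apply/seteqP; split=> y [] //; last by move=> [].
  by move=> Ey ya; split=> //; split=> //; exact: lt_trans ya ag.
have clbx x : D x -> clb (extend_Cseq dl E) [:: x] = clb C [:: x].
  by move=> /(idx_single (ltn0Sn 0) axC) xC; exact: clbE.
have clbdl : clb (extend_Cseq dl E) [:: dl] = E by rewrite /= eqxx.
have idx_size g : idx (extend_Cseq dl E) g -> (size g <= 1)%N.
  by case=> [/sub[]//|->].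
split; last exact: clbE.
- split.
    exists (osucc dl).
      by apply: contra_not infD; apply: sub_finite_set => x xD; apply: D1e; left.
    have cof : ssup (D `|` [set dl])%classic = ssup (below (osucc dl)).
      apply: (cofinal_ssup hO (@subset_refl _ _) D1e) => x.
      by rewrite /below /= (lt_osuccE hO) => xdl; exists dl => //; right.
    split=> // b /(accpE hO)[]; rewrite cof (ssup_below hO) (lt_osuccE hO) le_eqVlt.
    move=> /predU1P[-> _|bdl [b0 lb]]; first by right.
    left; apply: cD; apply/(accpE hO); split=> //; split=> // x /lb[y [Dy xy yb]].
    exists y; split=> //; case: Dy yb => // ->; rewrite ltNge => /negP[].
    exact: ltW.
  split=> //.
  + move=> g [/sub[gs gn gD]|->]; first by split=> // x /gD; left.
    by split=> // x; rewrite inE => /eqP ->; right.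
  + by left.
  + move=> x [|y g]; last by case.
    move=> [_ _ /(_ x)]; rewrite mem_head => /(_ isT) D1x; split.
      split=> [|_]; first by split=> //; left.
      by case: D1x => [/(idx_single (ltn0Sn 0) axC) ?|->]; [left|right].
    move=> _; case: D1x => [Dx|->].
      rewrite clbx //= [X in club _ X](_ : _ = below x `&` clb C [::])%classic.
        by have [] := idx_cons axC (idx_single (ltn0Sn 0) axC Dx).
      rewrite CD; apply/seteqP; split=> y [yx]; last by split=> //; left.
      move=> [//|ydl]; move: yx; rewrite ydl /below /= ltNge => /negP[].
      exact/ltW/D_dl.
    rewrite clbdl /= [X in club _ X](_ : _ = D).
      split=> // b /(accpE hO)[]; rewrite sE => bdl lb.
      by have [] := EE b bdl lb.
    apply/seteqP; split=> [y [ydl [//|yE]]|y Dy]; last by split; [exact: D_dl|left].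
    by move: ydl; rewrite yE /below /= ltxx.
- move=> a [_ [g [gC g1 ag]]].
  have key h : idx (extend_Cseq dl E) h -> size h = 1%N ->
      acc (clb (extend_Cseq dl E) h) a ->
      (clb (extend_Cseq dl E) h `&` below a)%classic =
        clb (extend_Cseq dl E) [:: a].
    case: h => [//|x [|//]] /idx_single'[Dx _|-> _].
      rewrite clbx // => axacc; have xC := idx_single (ltn0Sn 0) axC Dx.
      have Da : D a by case: axacc => /(clb_sub axC xC).
      rewrite clbx //; have [|h _] := coh a; last exact: h.
      by split; [rewrite CD|exists [:: x]].
    rewrite clbdl => -[Ea /(accpE hO)[]]; rewrite sE => adl la.
    by rewrite (clbx _ (ED _ Ea)); have [_ [_ ->]] := EE a adl la.
  (* Indices have length at most 1, so clause (ii) concerns only the sequence ⟨a⟩ itself. *)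
  split=> // b /idx_size; rewrite ltnS leqn0 => /nilP -> //.
- apply/seteqP; split=> [g [[//|->] [_ _ /(_ dl)]]|g gC].
    by rewrite mem_head /below /= ltxx => /(_ isT).
  by split; [left|have [gs gn gD] := sub _ gC; split=> // x /gD/D_dl].
Qed.

Lemma walk_length_nontrivial (p : O -> int) : infinite_set D ->
  coherent 1 C -> nontrivial 1 C ->
  ~ forall g, D g -> limpt D g -> exists2 eta, eta < g &
      forall x y, D x -> D y -> eta < x < g -> eta < y < g ->
        (walk_length 0 x g - p x = walk_length 0 y g - p y)%R.
Proof.
move=> infD coh ncl triv.
pose tail eta c g := forall x, D x -> eta < x -> x < g ->
  (walk_length 0 x g - p x = c)%R.
have [|eta [c [Deta unb]]] := @pressing_down tail.
  move=> g Dg lg; have [eta0 eta0g etaP] := triv g Dg lg.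
  have [eta [Deta eta0_eta etag]] := lg.2 _ eta0g.
  (* Any point z of D in (eta, g) supplies the constant value c. *)
  have [z [Dz etaz zg]] := lg.2 _ etag.
  exists eta, (walk_length 0 z g - p z)%R; split=> // x Dx etax xg.
  apply: etaP => //; first by rewrite xg (lt_trans eta0_eta).
  by rewrite zg (lt_trans eta0_eta).
pose S g := [/\ D g, limpt D g, eta < g & tail eta c g].
have unbS b : D b -> exists2 g, S g & b < g.
  move=> Db; have Dm : D (Order.max b eta) by rewrite /Order.max; case: ifP.
  have [g [Dg lg + tg]] := unb _ Dm.
  by rewrite gt_max => /andP[bg etag]; exists g.
have gC g : S g -> idx C [:: g].
  by move=> [Dg _ _ _]; exact: (idx_single (ltn0Sn 0) axC Dg).
have [_ _ CD _] := axC.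
have gsub g : below g `&` clb C [::] `<=` below e by move=> y [_]; rewrite CD => /De.
(* For y in C_g above eta, the walks from g and from h to y have equal length, namely 2, so y lies
   in C_h. Thus g is a limit of C_h, and coherence makes C_g an initial segment of C_h. *)
have cohS g h : S g -> S h -> g < h -> (clb C [:: h] `&` below g)%classic = clb C [:: g].
  move=> Sg Sh gh; have [Dg lg etag tg] := Sg; have [Dh lh etah th] := Sh.
  have [_ _ clg] := idx_cons axC (gC g Sg); have [_ _ clh] := idx_cons axC (gC h Sh).
  have lgg : limpt (clb C [:: g]) g.
    by apply: (limpt_club hO De _ lg); rewrite -CD.
  have lhg : limpt (clb C [:: h]) g.
    split=> [|x xg]; first by case: lg.
    have [|y [Cy my yg]] := lgg.2 (Order.max x eta); first by rewrite gt_max xg.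
    move: my; rewrite gt_max => /andP[xy etay].
    have Dy := clb_sub axC (gC g Sg) Cy; have yh := lt_trans yg gh.
    exists y; split=> //; apply/(walk_length_eq2 Dy Dh yh).
    have <- : walk_length 0 y g = walk_length 0 y h.
      by apply: (addIr (- p y)%R); rewrite (tg y) ?(th y).
    by apply/(walk_length_eq2 Dy Dg yg).
  have hgB : (below h `&` clb C [::])%classic g by rewrite CD.
  have hg : clb C [:: h] g by exact: (club_limpt hO (gsub h) clh hgB lhg).
  have [|coh1 _] := coh g; last apply: coh1 => //; [|exact: gC|].
    split; first by rewrite CD.
    exists [:: h]; split=> //; first exact: gC.
    split=> //; apply/(accpE hO); split=> //; apply: (lt_ssup hO (b := e) _ hg).
    by move=> y /(clb_sub axC (gC h Sh))/De.
  split=> //; apply/(accpE hO); split=> //; apply: (lt_ssup hO (b := e) _ hg).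
  by move=> y /(clb_sub axC (gC h Sh))/De.
pose E := [set x | exists2 g, S g & clb C [:: g] x].
have cutE g : S g -> clb C [:: g] = (E `&` below g)%classic.
  move=> Sg; apply/seteqP; split=> [x gx|x [[h Sh hx] xg]].
    by split; [exists g|exact: (clb_lt axC (gC g Sg) gx)].
  have [gh|hg|gh] := ltgtP g h; last by rewrite gh.
    by rewrite -(cohS g h) //; split.
  by move: hx; rewrite -(cohS h g) // => -[].
apply: (@extension_not_nontrivial E) ncl => //.
- by move=> x [g Sg gx]; exact: (clb_sub axC (gC g Sg)) gx.
- move=> x Dx; have [g Sg xg] := unbS x Dx.
  have [_ _ clg] := idx_cons axC (gC g Sg).
  have [|y gy xy] := club_cofinal hO (gsub g) clg (x := x); first by rewrite CD.
  by exists y => //; exists g.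
- move=> a adl la; have [b Db ab] := ssup_cofinal hO De adl.
  have [g Sg bg] := unbS b Db; have [Dg lg _ _] := Sg.
  by exists g; split=> //; [exact: le_lt_trans ab bg|exact: cutE].
Qed.

End BaseCase.

(** * The induction on n *)

Section Nontriviality.
Context {d : Order.disp_t} {O : bOrderType d} (hO : ordinals_like O).
Implicit Types (C : @Cseq d O) (D : set O).

(** For n = 1 the sum is just psi at the empty sequence, so both clauses of [trivial_mod_lsc] take
    this form. *)
Definition walk_defect (n : nat) C (psi : seq O -> O -> {freeg (seq O)})
    (g : seq O) (a : O) : {freeg (seq O)} :=
  (walk_r n C a g - \sum_(i < n) psi (del i g) a *~ (-1) ^+ i)%R.

(** Semi-constancy at the single limit g, tested on D only. This weak form passes from D to its
    subset [clb C [:: z]]. *)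
Definition tail_constant D (g : O) (f : O -> {freeg (seq O)}) : Prop :=
  exists2 eta : O, eta < g & forall x y, D x -> D y ->
    eta < x < g -> eta < y < g -> f x = f y.

(** Each support is finite, so F bounds its last entries; the sequences a :: g with entries up to x
    are then handled by [regular_set_seq_bound]. Consequently a closure point z of G is never a last
    entry in the support of psi_g(a) when g and a are below z. *)
Lemma bounding_function D k (psi : seq O -> O -> {freeg (seq O)}) :
  regular_set D -> exists G : O -> O, (forall x, D x -> D (G x)) /\
    forall x g a e z, D x -> D a -> a <= x -> size g = k ->
      (forall y, y \in g -> D y /\ y <= x) ->
      D z -> rcons e z \in dom (psi g a) -> z <= G x.
Proof.
move=> rD; have [D0 nomax _ _] := rD.
have /choice[F FP] : forall s, exists b, D b /\ forall e z, D z ->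
    rcons e z \in dom (psi (behead s) (head \bot s)) -> z <= b.
  move=> s; have [b Db bP] := regular_set_list_max
    [seq last \bot e | e <- dom (psi (behead s) (head \bot s))] D0.
  exists b; split=> // e z Dz ez; apply: bP => //.
  by apply/mapP; exists (rcons e z); rewrite ?last_rcons.
have /choice[G GP] : forall x, exists b, D x -> D b /\ forall s, size s = k.+1 ->
    (forall y, y \in s -> D y /\ y <= x) -> F s <= b.
  move=> x; have [Dx|] := pselect (D x); last by exists x.
  (* The bound on sequences wants a strict upper bound of the entries, hence x' > x. *)
  have [x' Dx' xx'] := nomax x Dx.
  have [b Db bP] := regular_set_seq_bound k.+1 rD Dx' (fun s => (FP s).1).
  exists b => _; split=> // s sk sx; apply: bP => // y /sx[Dy yx].
  by split=> //; exact: le_lt_trans xx'.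
exists G; split=> [x /GP[]//|x g a e z Dx Da ax gk gx Dz ez].
apply: le_trans ((FP (a :: g)).2 e z Dz ez) _; apply: (GP x Dx).2 => /=.
  by rewrite gk.
by move=> y; rewrite inE => /predU1P[->//|/gx].
Qed.

(** The last term of the alternating sum deletes z and leaves psi_g, killed by hypothesis; every
    other term deletes an entry of g and keeps z. *)
Lemma walk_defect_last_part m D C e z psi g a : (0 < m)%N ->
  D `<=` below e -> Cseq_axioms m.+1 D C -> D z -> incr (clb C [:: z]) m g ->
  last_part z (psi g a) = 0%R ->
  last_part z (walk_defect m.+1 C psi (rcons g z) a) =
  walk_defect m (Csub m.+1 C z) (fun s a => last_part z (psi (rcons s z) a)) g a.
Proof.
move=> m0 De axC Dz gz psi0; have [_ gm _] := gz.
have lz : walk_label m (clb C [:: z]) (0%N, a :: g) by exists a, g.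
rewrite /walk_defect !walk_rE raddfB -(walk_sum_rcons hO m0 De axC Dz lz) /=.
congr (_ - _)%R; rewrite big_ord_recr raddfD raddf_sum /=.
rewrite -[in X in del X _]gm del_rcons_last raddfMz /= psi0 mul0rz addr0.
by apply: eq_bigr => i _; rewrite del_rcons ?gm // raddfMz.
Qed.

Lemma walk_nontrivial m : forall D C e psi, D `<=` below e ->
  accp D `<=` D -> Cseq_axioms m.+1 D C -> coherent m.+1 C ->
  strongly_nontrivial m.+1 C ->
  ~ forall g, incr D m.+1 g -> limpt D (head \bot g) ->
      tail_constant D (head \bot g) (walk_defect m.+1 C psi g).
Proof.
elim: m => [|m IH] D C e psi De cD axC coh.
  move=> [[k k_reg k_otp] ncl] triv; have [_ _ CD _] := axC.
  rewrite CD in k_otp; have rD := otp_regular_set hO k_reg k_otp.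
  have infD : infinite_set D.
    move=> /(finite_image)finD; have [f [_ fD]] := k_otp.
    have := finD _ f; rewrite fD => /finite_set_countable.
    by case: k_reg.
  pose p a := coeff [::] (psi [::] a).
  apply: (walk_length_nontrivial hO De axC cD rD (p := p) infD coh ncl).
  move=> g Dg lg; have [|eta etag etaP] := triv [:: g] (incr_single Dg); first exact: lg.
  exists eta => // x y Dx Dy xP yP.
  have := congr1 (coeff [::]) (etaP x y Dx Dy xP yP).
  by rewrite /walk_defect !big_ord_recl !big_ord0 !addr0 !mulr1z !coeffB.
move=> [[k k_reg k_otp] stat] triv; have [_ _ CD _] := axC.
rewrite CD in k_otp stat; have rD := otp_regular_set hO k_reg k_otp.
have [G [GD GP]] := bounding_function m.+1 psi rD.
(* Stationarity provides a closure point z of G with C^z strongly nontrivial. *)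
have [z [[Dz snz] [_ lz zG]]] := stat _ (closure_points_club hO De cD rD GD).
have zC := idx_single (ltn0Sn m.+1) axC Dz.
have [_ _ [CzD sCz cCz]] := idx_cons axC zC.
have Cze : clb C [:: z] `<=` below e by move=> y /(clb_sub axC zC)/De.
apply: (IH _ _ e (fun s a => last_part z (psi (rcons s z) a)) Cze cCz
  (Csub_axioms (ltn0Sn m) axC Dz) (Csub_coherent hO (ltn0Sn m) De axC Dz coh) snz).
move=> g gz lg.
have [gs gm gzD] := gz.
have g0 : head \bot (rcons g z) = head \bot g by case: (g) gm.
have gD := incr_rcons axC Dz gz.
have CD' := clb_sub axC zC.
have [|eta etag etaP] := triv _ gD; first by rewrite g0; exact: limptS CD' lg.
rewrite g0 in etag etaP; exists eta => // x y Cx Cy xP yP.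
(* The last entry x' of g bounds w and all of g, and x' < z. So if z ended a basis element in the
   support of psi_g(w), then z <= G x' < z. *)
have psi0 w : clb C [:: z] w -> w < head \bot g -> last_part z (psi g w) = 0%R.
  move=> Cw wg; apply: last_part_eq0 => e'; apply/negP => ez.
  pose x' := last \bot g.
  have x'g : x' \in g by rewrite /x'; case: (g) gm => //= y' g' _; exact: mem_last.
  have gx' y' : y' \in g -> y' <= x'.
    rewrite /x'; case/lastP: (g) gs => // g' z' /lt_sorted_rcons gs'.
    by rewrite last_rcons mem_rcons inE => /predU1P[->//|/gs'/ltW].
  have Dx' := gzD _ x'g; have x'z := clb_lt axC zC Dx'.
  have wx' : w <= x'.
    apply: le_trans (ltW wg) _; apply: gx'.
    by case: (g) gm => //= *; exact: mem_head.
  have gDx' y' : y' \in g -> D y' /\ y' <= x'.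
    by move=> y'g; split; [exact/CD'/gzD|exact: gx'].
  have := GP x' g w e' z (CD' _ Dx') (CD' _ Cw) wx' gm gDx' Dz ez.
  by rewrite leNgt zG //; exact: CD'.
have [[_ xg] [_ yg]] := (andP xP, andP yP).
rewrite -!(walk_defect_last_part (ltn0Sn m) De axC Dz gz) ?psi0 //.
by congr (last_part z _); apply: etaP => //; exact: CD'.
Qed.

End Nontriviality.

Theorem theoremC (d : Order.disp_t) (O : bOrderType d) (hO : ordinals_like O)
    (n : nat) (hn : (1 <= n)%N)
    (lam : O) (hlam : regular_uncountable lam)
    (C : @Cseq d O) (hC : Sq_s n lam C) :
  let H := free_incr lam n.-1 in
  let Phi := fun (g : seq O) (a : O) => walk_r n C a g in
  family_in H n lam Phi /\ ~ trivial_mod_lsc H n lam Phi.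
Proof.
move=> H Phi; have [[_ axC] coh snC] := hC.
have De : below lam `<=` below lam by [].
have cD : accp (below lam) `<=` below lam.
  by move=> b /(accpE hO)[]; rewrite (ssup_below hO).
split=> [g gl a ag e|].
  (* Values in H: every contribution is indexed by a label without its first two entries, a strictly
     increasing sequence of length n-1, so the coefficient at any other e vanishes. *)
  rewrite mem_dom => /eqP; apply: contra_notP => ne.
  apply: (walk_sum_vanish hO hn axC (P := fun=> True) (phi := coeff e) De) => //;
    last by exists a, g.
  move=> l [a' [g' [lE [g's g'n g'l]]]] _; rewrite /contribution lE /= coeffU drop1.
  case: eqP => [g'e|_]; last by rewrite mulr0.
  case: ne; rewrite -g'e; split.
  - by case: (g') g's => //= x s /path_sorted.
  - by rewrite size_behead g'n.
  - by move=> x /mem_behead/g'l.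
have limE g : limpt (below lam) g -> limit_ordinal g.
  move=> lg; apply: (limpt_below_limit hO); split=> [|x xg]; first by case: lg.
  by have [y [_ xy yg]] := lg.2 x xg; exists y.
rewrite {}/H {}/Phi; case: n hn C hC axC coh snC => // m _ C _ axC coh snC.
move=> [[m0 [psi [_ lsc]]]|[m1 [psi [_ lsc]]]].
  case: m0 => m0; subst m.
  apply: (walk_nontrivial hO (psi := fun=> psi) De cD axC coh snC) => g [_ g1 gl] lg.
  case: g g1 gl lg => [//|g [|//]] _ gl lg.
  (* Local semi-constancy is used at the top point g of the domain only. *)
  have [|eta etag etaP] := lsc g (gl g (mem_head _ _)) g (lexx g); first exact: limE.
  exists eta => // x y _ _ xP yP; have := etaP x y xP yP.
  by rewrite /walk_defect !big_ord_recl !big_ord0 !addr0 !mulr1z.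
apply: (walk_nontrivial hO (psi := psi) De cD axC coh snC) => g gl lg.
have [eta etag etaP] := lsc g gl _ (lexx _) (limE _ lg).
by exists eta => // x y _ _; exact: etaP.
Qed.
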